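(* Let $m\ge 2$. If $m=2k$, let $\beta_f(m)=\frac{k+1+\sqrt{k^2+6k+1}}{2}$ (the positive root of $x^2-(k+1)x-k=0$). Then: (1) $|W_{\beta,m}|=1$ for $\beta\in(\mathcal{G}(m),\beta_f(m)]$; (2) $|W_{\beta,m}|=\aleph_0$ for $\beta\in(\beta_f(m),\beta_c(m))$; (3) $|W_{\beta,m}|=2^{\aleph_0}$ for $\beta=\beta_c(m)$; (4) $W_{\beta,m}$ has positive Hausdorff dimension for $\beta\in(\beta_c(m),m+1]$. If $m=2k+1$, let $\beta_f(m)$ be the largest real root of $x^3-(k+2)x^2+x-(k+1)=0$. Then: (1) $|W_{\beta,m}|=2$ for $\beta\in(\mathcal{G}(m),\beta_f(m)]$; (2) $|W_{\beta,m}|=\aleph_0$ for $\beta\in(\beta_f(m),\beta_c(m))$; (3) $|W_{\beta,m}|=2^{\aleph_0}$ for $\beta=\beta_c(m)$; (4) $W_{\beta,m}$ has positive Hausdorff dimension for $\beta\in(\beta_c(m),m+1]$.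
   Context: For $\beta\in(1,m+1]$ and $x\in[0,\frac{m}{\beta-1}]$ let $\Sigma_{\beta,m}(x)=\{(\epsilon_i)\in\{0,\ldots,m\}^{\mathbb{N}}:\sum_{i\ge1}\epsilon_i\beta^{-i}=x\}$. Let $W_{\beta,m}=\{x\in(\frac{m+1-\beta}{\beta-1},1): |\Sigma_{\beta,m}(x)|=1\}$. Define $\mathcal{G}(m)=k+1$ if $m=2k$ and $\mathcal{G}(m)=\frac{k+1+\sqrt{k^2+6k+5}}{2}$ if $m=2k+1$. Let $(\lambda_i)_{i\ge0}$ be the Thue–Morse sequence: $\lambda_0=0$, $\lambda_{2i}=\lambda_i$, $\lambda_{2i+1}=1-\lambda_i$. For $i\ge1$ set $\lambda_i(m)=k+\lambda_i-\lambda_{i-1}$ if $m=2k$ and $\lambda_i(m)=k+\lambda_i$ if $m=2k+1$. Let $\beta_c(m)$ be the unique solution $\beta>1$ of $\sum_{i=1}^\infty \lambda_i(m)\beta^{-i}=1$. Hausdorff dimension is with respect to the usual metric on $\mathbb{R}$. *)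

(* Defs.v *)
From Stdlib Require Import Reals Lra Lia.
From Coquelicot Require Import Coquelicot.
Open Scope R_scope.

(* A digit sequence (eps_i)_{i>=1} is represented by eps : nat -> nat with
   eps j standing for eps_{j+1}. *)
Definition Sigma (beta : R) (m : nat) (x : R) (eps : nat -> nat) : Prop :=
  (forall j, (eps j <= m)%nat) /\
  is_series (fun j => INR (eps j) / beta ^ (S j)) x.

Definition unique_expansion (beta : R) (m : nat) (x : R) : Prop :=
  exists eps, Sigma beta m x eps /\
    forall eps', Sigma beta m x eps' -> forall j, eps' j = eps j.

Definition W (beta : R) (m : nat) (x : R) : Prop :=
  (INR m + 1 - beta) / (beta - 1) < x < 1 /\ unique_expansion beta m x.

Definition card_eq1 (A : R -> Prop) : Prop :=
  exists a, forall y, A y <-> y = a.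
Definition card_eq2 (A : R -> Prop) : Prop :=
  exists a b, a <> b /\ forall y, A y <-> (y = a \/ y = b).
Definition countably_infinite (A : R -> Prop) : Prop :=
  exists f : nat -> R, (forall n n', f n = f n' -> n = n') /\
    forall y, A y <-> exists n, f n = y.
Definition continuum_card (A : R -> Prop) : Prop :=
  exists f : (nat -> bool) -> R, (forall u v, f u = f v -> u = v) /\
    forall y, A y <-> exists u, f u = y.

Definition diam (U : R -> Prop) : Rbar :=
  Rbar_lub (fun v => v = Finite 0 \/
              exists x y, U x /\ U y /\ v = Finite (Rabs (x - y))).

(* d^s, with the convention 0^s = 0 (s > 0) *)
Definition pw (d s : R) : R := if Rle_dec d 0 then 0 else Rpower d s.

(* sum of a series of nonnegative terms, in [0, +oo] *)
Definition sumNN (f : nat -> R) : Rbar :=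
  Rbar_lub (fun v => exists n, v = Finite (sum_f_R0 f n)).

Definition hausdorff_delta (s delta : R) (A : R -> Prop) : Rbar :=
  Rbar_glb (fun v => exists U : nat -> (R -> Prop),
     (forall x, A x -> exists i, U i x) /\
     (forall i, Rbar_le (diam (U i)) (Finite delta)) /\
     v = sumNN (fun i => pw (real (diam (U i))) s)).

Definition hausdorff_measure (s : R) (A : R -> Prop) : Rbar :=
  Rbar_lub (fun v => exists delta, 0 < delta /\ v = hausdorff_delta s delta A).

Definition hausdorff_dim (A : R -> Prop) : Rbar :=
  Rbar_glb (fun v => exists s, 0 < s /\ hausdorff_measure s A = Finite 0 /\
                               v = Finite s).

Definition calG (m : nat) : R :=
  let k := INR (Nat.div2 m) in
  if Nat.even m then k + 1
  else (k + 1 + sqrt (k ^ 2 + 6 * k + 5)) / 2.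

Fixpoint tm_aux (fuel n : nat) : nat :=
  match fuel with
  | O => O
  | S f => match n with
           | O => O
           | _ => if Nat.even n then tm_aux f (Nat.div2 n)
                  else (1 - tm_aux f (Nat.div2 n))%nat
           end
  end.
Definition thue_morse (n : nat) : nat := tm_aux (S n) n.

(* lambda_i(m), i >= 1 *)
Definition lam (m i : nat) : R :=
  let k := INR (Nat.div2 m) in
  if Nat.even m then k + INR (thue_morse i) - INR (thue_morse (i - 1))
  else k + INR (thue_morse i).

Definition is_beta_c (m : nat) (beta : R) : Prop :=
  1 < beta /\ is_series (fun j => lam m (S j) / beta ^ (S j)) 1.

Definition beta_f_even (k : nat) : R :=
  (INR k + 1 + sqrt (INR k ^ 2 + 6 * INR k + 1)) / 2.

Definition cubic_odd (k : nat) (x : R) : R :=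
  x ^ 3 - (INR k + 2) * x ^ 2 + x - (INR k + 1).

Definition is_beta_f_odd (k : nat) (b : R) : Prop :=
  cubic_odd k b = 0 /\ forall x, cubic_odd k x = 0 -> x <= b.

(* Main.v *)
(* Unique expansions in W are the sequences whose tails all have value in the open interval
   (m/(beta-1) - 1, 1). For beta <= beta_c such a sequence is governed by a binary sequence b:
   the digits are k + b_n if m = 2k+1 and k + b_(n+1) - b_n if m = 2k, and the condition becomes
   that after each 0 the tail of b has base-beta value below a threshold t(beta), and dually
   after each 1. The equation defining beta_c says t = tau, where tau(beta) is the value of the
   Thue-Morse tail 1101 0011 ..., and t - tau has the sign of beta - beta_c.

   The substitution phi : 0 -> 01, 1 -> 10 conjugates the condition for (beta^2, t') with the one
   for (beta, t), where t' is affine in t, and it multiplies the gap t - tau by beta/(beta-1) > 1,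
   whereas tau tends to 0 along beta, beta^2, beta^4, ... If t < tau, the threshold eventually
   becomes nonpositive and every admissible sequence is eventually periodic. If t = tau, the
   sequences 0^(1+a_0) phi(0^(1+a_1) phi(...)) are admissible for all binary a. If t > tau, some
   iterate of phi sends all binary sequences to admissible ones, and W contains an affine image
   of a self-similar Cantor set. *)
Require Import Defs.
From Stdlib Require Import Reals Lra Lia Arith.
From Stdlib Require Import Classical ClassicalEpsilon IndefiniteDescription FunctionalExtensionality.
From Stdlib Require Cantor.
From Coquelicot Require Import Coquelicot.
Open Scope R_scope.

(** * Values of digit sequences *)

(** Thresholds are real numbers compared with values, not words compared lexicographically: this
    makes the renormalization an affine map of [t] and lets both parities of m share it. All bases
    in question exceed k+1 >= 2, so order by value is still lexicographic order.

    The other constants are threshold crossings too. As beta grows, [t] passes the values of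
    0^infinity, (10)^infinity, (1100)^infinity and finally the Thue-Morse tail. For m = 2k the first
    two crossings are G(m) and beta_f(m). For m = 2k+1 they are the second and the third, because
    there the bound is imposed on every tail, not only after a 0 or dually after a 1: up to
    beta_f(m) this excludes the constant sequences and leaves only (10)^infinity and (01)^infinity.

    If t <= 1/(beta-1) and t is at least the value of 11 followed by zeros, a sequence starting with
    01 that meets the weaker condition meets the stronger one. So the odd case borrows the sequences
    of the even case, built in base beta^2, through one application of phi. *)

Definition dval (beta : R) (u : nat -> R) : R := Series (fun j => u j / beta ^ (S j)).

Definition shift {T : Type} (n : nat) (u : nat -> T) : nat -> T := fun j => u (j + n)%nat.

Definition flip (b : nat -> bool) : nat -> bool := fun j => negb (b j).

Definition bit (x : bool) : R := if x then 1 else 0.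

Definition bval (beta : R) (b : nat -> bool) : R := dval beta (fun j => bit (b j)).

Lemma bit_bounds (x : bool) : 0 <= bit x <= 1.
Proof. destruct x; simpl; lra. Qed.

(** Partial sums telescope to [r 0 - r (n+1) / beta^(n+1)], and boundedness kills the remainder.
    Digit series are evaluated below by exhibiting such a bounded orbit. *)
Lemma is_series_orbit (beta M : R) (u r : nat -> R) :
  1 < beta -> (forall n, r (S n) = beta * r n - u n) -> (forall n, Rabs (r n) <= M) ->
  is_series (fun j => u j / beta ^ (S j)) (r O).
Proof.
  intros Hb Hr HM.
  assert (Hs : forall n, sum_n (fun j => u j / beta ^ (S j)) n = r O - r (S n) / beta ^ (S n)).
  { induction n as [|n IH].
    - rewrite sum_O, Hr. simpl. field. lra.
    - rewrite sum_Sn, IH, (Hr (S n)). unfold plus; simpl.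
      assert (beta ^ n <> 0) by (apply pow_nonzero; lra). field; split; first [assumption | lra]. }
  assert (Hlim : is_lim_seq (sum_n (fun j => u j / beta ^ (S j))) (r O)); [|exact Hlim].
  apply is_lim_seq_ext with (fun n => r O - r (S n) / beta ^ (S n)).
  { intros n. symmetry. apply Hs. }
  replace (Finite (r O)) with (Finite (r O - 0)) by (f_equal; ring).
  apply is_lim_seq_minus'; [apply is_lim_seq_const|].
  apply is_lim_seq_incr_1 with (u := fun n => r n / beta ^ n).
  apply is_lim_seq_abs_0.
  assert (Hg : is_lim_seq (fun n => M * (/ beta) ^ n) 0).
  { replace (Finite 0) with (Rbar_mult M 0) by (simpl; f_equal; ring).
    apply is_lim_seq_scal_l, is_lim_seq_geom.
    rewrite Rabs_right; [|left; apply Rinv_0_lt_compat; lra].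
    rewrite <- Rinv_1. apply Rinv_lt_contravar; lra. }
  apply is_lim_seq_le_le with (fun _ => 0) (fun n => M * (/ beta) ^ n);
    [|apply is_lim_seq_const|exact Hg].
  intros n. split; [apply Rabs_pos|].
  assert (0 < beta ^ n) by (apply pow_lt; lra).
  unfold Rdiv. rewrite Rabs_mult, pow_inv, (Rabs_right (/ _));
    [|left; apply Rinv_0_lt_compat; assumption].
  apply Rmult_le_compat_r; [left; apply Rinv_0_lt_compat; assumption|apply HM].
Qed.

Lemma dval_orbit (beta M : R) (u r : nat -> R) :
  1 < beta -> (forall n, r (S n) = beta * r n - u n) -> (forall n, Rabs (r n) <= M) ->
  dval beta u = r O.
Proof.
  intros Hb Hr HM. apply is_series_unique. eapply is_series_orbit; eassumption.
Qed.

Lemma is_series_const (beta c : R) :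
  1 < beta -> is_series (fun j => c / beta ^ (S j)) (c / (beta - 1)).
Proof.
  intros Hb.
  apply (is_series_orbit beta (Rabs (c / (beta - 1))) (fun _ => c) (fun _ => c / (beta - 1)));
    [assumption| |intros; lra].
  intros _. field. lra.
Qed.

Lemma dval_const (beta c : R) : 1 < beta -> dval beta (fun _ => c) = c / (beta - 1).
Proof. intros Hb. apply is_series_unique, is_series_const, Hb. Qed.

Lemma ex_dval (beta M : R) (u : nat -> R) :
  1 < beta -> (forall j, Rabs (u j) <= M) -> ex_series (fun j => u j / beta ^ (S j)).
Proof.
  intros Hb HM. apply (ex_series_le (K := R_AbsRing) (V := R_CompleteNormedModule))
    with (fun j => M / beta ^ (S j)).
  - intros j. change (Rabs (u j / beta ^ (S j)) <= M / beta ^ (S j)).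
    assert (0 < beta ^ (S j)) by (apply pow_lt; lra).
    unfold Rdiv. rewrite Rabs_mult, (Rabs_right (/ _));
      [|left; apply Rinv_0_lt_compat; assumption].
    apply Rmult_le_compat_r; [left; apply Rinv_0_lt_compat; assumption|apply HM].
  - eexists. apply is_series_const, Hb.
Qed.

Lemma dval_unfold (beta M : R) (u : nat -> R) :
  1 < beta -> (forall j, Rabs (u j) <= M) -> dval beta u = (u O + dval beta (shift 1 u)) / beta.
Proof.
  intros Hb HM. unfold dval. rewrite Series_incr_1; [|apply ex_dval with M; assumption].
  rewrite <- (Series_ext (fun k => / beta * (shift 1 u k / beta ^ (S k)))).
  - rewrite Series_scal_l. simpl. field. lra.
  - intros n. unfold shift. rewrite Nat.add_1_r. simpl.
    assert (beta ^ n <> 0) by (apply pow_nonzero; lra). field; split; first [assumption | lra].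
Qed.

Lemma dval_range (beta p q : R) (u : nat -> R) :
  1 < beta -> 0 <= p -> (forall j, p <= u j <= q) ->
  p / (beta - 1) <= dval beta u <= q / (beta - 1).
Proof.
  intros Hb Hp Hu.
  assert (Hpow : forall n, 0 < / beta ^ (S n)).
  { intros n. apply Rinv_0_lt_compat, pow_lt. lra. }
  rewrite <- !dval_const by assumption. split; apply Series_le.
  - intros n. specialize (Hpow n). specialize (Hu n). unfold Rdiv. split; [nra|].
    apply Rmult_le_compat_r; lra.
  - apply ex_dval with q; [assumption|]. intros j. specialize (Hu j). rewrite Rabs_right; lra.
  - intros n. specialize (Hpow n). specialize (Hu n). unfold Rdiv. split; [nra|].
    apply Rmult_le_compat_r; lra.
  - eexists. apply is_series_const, Hb.
Qed.

Lemma bval_range (beta : R) (b : nat -> bool) : 1 < beta -> 0 <= bval beta b <= / (beta - 1).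
Proof.
  intros Hb.
  assert (H := dval_range beta 0 1 (fun j => bit (b j)) Hb (Rle_refl 0) (fun j => bit_bounds (b j))).
  unfold bval. unfold Rdiv in H. lra.
Qed.

Lemma bval_unfold (beta : R) (b : nat -> bool) :
  1 < beta -> bval beta b = (bit (b O) + bval beta (shift 1 b)) / beta.
Proof.
  intros Hb. apply dval_unfold with 1; [assumption|].
  intros j. rewrite Rabs_right; destruct (b j); simpl; lra.
Qed.

Lemma shift_shift {T : Type} (p q : nat) (u : nat -> T) : shift p (shift q u) = shift (p + q) u.
Proof. extensionality j. unfold shift. f_equal. lia. Qed.

Lemma shift_0 {T : Type} (u : nat -> T) : shift 0 u = u.
Proof. extensionality j. unfold shift. f_equal. lia. Qed.

Lemma flip_flip (b : nat -> bool) : flip (flip b) = b.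
Proof. extensionality j. apply Bool.negb_involutive. Qed.

Lemma bval_shift (beta : R) (b : nat -> bool) (n : nat) :
  1 < beta -> bval beta (shift (S n) b) = beta * bval beta (shift n b) - bit (b n).
Proof.
  intros Hb. rewrite (bval_unfold beta (shift n b)) by assumption.
  rewrite shift_shift. simpl. unfold shift at 2. simpl. field. lra.
Qed.

Lemma bval_orbit (beta M : R) (b : nat -> bool) (r : nat -> R) :
  1 < beta -> (forall n, r (S n) = beta * r n - bit (b n)) -> (forall n, Rabs (r n) <= M) ->
  bval beta b = r O.
Proof. apply dval_orbit. Qed.

Lemma bval_flip (beta : R) (b : nat -> bool) : 1 < beta -> bval beta (flip b) = / (beta - 1) - bval beta b.
Proof.
  intros Hb.
  rewrite (bval_orbit beta (/ (beta - 1)) (flip b) (fun n => / (beta - 1) - bval beta (shift n b)));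
    [now rewrite shift_0|assumption| |].
  - intros n. rewrite bval_shift by assumption. unfold flip.
    destruct (b n); simpl; field; lra.
  - intros n. assert (H := bval_range beta (shift n b) Hb). rewrite Rabs_right; lra.
Qed.

Lemma inv_base_lt_1 (beta : R) : 2 < beta -> 0 < / (beta - 1) < 1.
Proof.
  intros Hb. split; [apply Rinv_0_lt_compat; lra|].
  rewrite <- Rinv_1. apply Rinv_lt_contravar; lra.
Qed.

(** A tail is worth at most 1/(beta-1), which is less than 1 once beta > 2. This gap makes the order
    by value lexicographic and the coding by bits injective. *)
Lemma bval_false_lt (beta : R) (b : nat -> bool) : 2 < beta -> b O = false -> bval beta b < / beta.
Proof.
  intros Hb H0. rewrite bval_unfold, H0 by lra. simpl.
  assert (H1 := bval_range beta (shift 1 b) ltac:(lra)).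
  assert (H2 := inv_base_lt_1 beta Hb).
  unfold Rdiv. rewrite <- (Rmult_1_l (/ beta)) at 2.
  apply Rmult_lt_compat_r; [apply Rinv_0_lt_compat; lra|lra].
Qed.

Lemma bval_true_ge (beta : R) (b : nat -> bool) : 1 < beta -> b O = true -> / beta <= bval beta b.
Proof.
  intros Hb H0. rewrite bval_unfold, H0 by lra. simpl.
  assert (H1 := bval_range beta (shift 1 b) ltac:(lra)).
  unfold Rdiv. rewrite <- (Rmult_1_l (/ beta)) at 1.
  apply Rmult_le_compat_r; [left; apply Rinv_0_lt_compat; lra|lra].
Qed.

Lemma bval_lex_lt (beta : R) (p : nat) (u v : nat -> bool) :
  2 < beta -> (forall j, (j < p)%nat -> u j = v j) -> u p = false -> v p = true ->
  bval beta u < bval beta v.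
Proof.
  intros Hb. revert u v. induction p as [|p IH]; intros u v Heq Hu Hv.
  - apply Rlt_le_trans with (/ beta); [apply bval_false_lt|apply bval_true_ge]; auto; lra.
  - rewrite (bval_unfold beta u), (bval_unfold beta v), (Heq O) by (lia || lra).
    unfold Rdiv. apply Rmult_lt_compat_r; [apply Rinv_0_lt_compat; lra|].
    apply Rplus_lt_compat_l, IH.
    + intros j Hj. apply Heq. lia.
    + unfold shift. now rewrite Nat.add_1_r.
    + unfold shift. now rewrite Nat.add_1_r.
Qed.

Lemma bval_inj (beta : R) (u v : nat -> bool) : 2 < beta -> bval beta u = bval beta v -> u = v.
Proof.
  intros Hb HZ. extensionality n.
  induction n as [n IH] using (well_founded_induction Nat.lt_wf_0).
  destruct (u n) eqn:Eu, (v n) eqn:Ev; auto; exfalso.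
  - assert (H : bval beta v < bval beta u); [|lra].
    apply bval_lex_lt with n; auto. intros j Hj. symmetry. now apply IH.
  - assert (H : bval beta u < bval beta v); [|lra]. apply bval_lex_lt with n; auto.
Qed.

Lemma bval_antitone (beta beta' : R) (b : nat -> bool) :
  1 < beta -> beta <= beta' -> bval beta' b <= bval beta b.
Proof.
  intros Hb Hle. unfold bval, dval. apply Series_le.
  - intros n. assert (H := bit_bounds (b n)).
    assert (0 < beta ^ (S n)) by (apply pow_lt; lra).
    assert (beta ^ (S n) <= beta' ^ (S n)) by (apply pow_incr; lra).
    split; unfold Rdiv.
    + apply Rmult_le_pos; [lra|]. left. apply Rinv_0_lt_compat. lra.
    + apply Rmult_le_compat_l; [lra|]. apply Rinv_le_contravar; lra.
  - apply ex_dval with 1; [assumption|]. intros j. destruct (b j); simpl; rewrite Rabs_right; lra.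
Qed.

(** * Unique expansions and confined orbits *)

(** Since beta <= m+1, the number M = m/(beta-1) is at least 1. The largest digit not exceeding
    [beta * r] therefore leaves a remainder in [0, M]: below 1 if the digit is less than m, and at
    most beta M - m = M otherwise. *)
Lemma expansion_exists (beta : R) (m : nat) (y : R) :
  1 < beta <= INR m + 1 -> 0 <= y <= INR m / (beta - 1) -> exists eps, Sigma beta m y eps.
Proof.
  intros [Hb Hbm] Hy.
  set (M := INR m / (beta - 1)) in *.
  assert (HM : M * (beta - 1) = INR m) by (unfold M; field; lra).
  assert (Hstep : forall r, 0 <= r <= M ->
            exists d, (d <= m)%nat /\ 0 <= beta * r - INR d <= M).
  { intros r Hr.
    assert (H : forall n, (n <= m)%nat -> INR n <= beta * r ->
              exists d, (d <= m)%nat /\ 0 <= beta * r - INR d <= M).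
    { intros n Hn. remember (m - n)%nat as l eqn:El. revert n Hn El.
      induction l as [|l IH]; intros n Hn El Hnr.
      - exists n. replace n with m in * by lia. split; [lia|]. split; [lra|nra].
      - destruct (Rle_dec (INR (S n)) (beta * r)) as [Hle|Hgt].
        + apply (IH (S n)); [lia|lia|assumption].
        + exists n. split; [lia|]. rewrite S_INR in Hgt. split; [lra|]. nra. }
    apply (H O); [lia|]. simpl. nra. }
  set (dig := fun r => epsilon (inhabits O)
                (fun d => (d <= m)%nat /\ 0 <= beta * r - INR d <= M)).
  assert (Hdig : forall r, 0 <= r <= M -> (dig r <= m)%nat /\ 0 <= beta * r - INR (dig r) <= M).
  { intros r Hr. unfold dig. apply epsilon_spec, Hstep, Hr. }
  set (r := fun n => Nat.iter n (fun r => beta * r - INR (dig r)) y).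
  assert (Hr : forall n, 0 <= r n <= M).
  { induction n as [|n IH]; [exact Hy|]. simpl. now apply Hdig. }
  exists (fun n => dig (r n)). split.
  - intros j. now apply Hdig.
  - apply (is_series_orbit beta M _ r); [assumption|reflexivity|].
    intros n. specialize (Hr n). rewrite Rabs_right; lra.
Qed.

Definition confined_orbit (beta : R) (m : nat) (eps : nat -> nat) (r : nat -> R) : Prop :=
  (forall j, (eps j <= m)%nat) /\
  (forall n, r (S n) = beta * r n - INR (eps n)) /\
  (forall n, INR m / (beta - 1) - 1 < r n < 1).

Lemma Sigma_orbit (beta : R) (m : nat) (x : R) (eps : nat -> nat) :
  1 < beta -> Sigma beta m x eps ->
  exists r, r O = x /\ (forall n, r (S n) = beta * r n - INR (eps n)) /\
    forall n, 0 <= r n <= INR m / (beta - 1).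
Proof.
  intros Hb [Heps Hx].
  assert (Hrange : forall j, 0 <= INR (eps j) <= INR m).
  { intros j. split; [apply pos_INR|apply le_INR, Heps]. }
  exists (fun n => dval beta (shift n (fun j => INR (eps j)))). split; [|split].
  - rewrite shift_0. apply is_series_unique, Hx.
  - intros n. rewrite (dval_unfold beta (INR m) (shift n _)).
    + rewrite shift_shift. simpl. unfold shift at 2. simpl. field. lra.
    + assumption.
    + intros j. unfold shift. specialize (Hrange (j + n)%nat). rewrite Rabs_right; lra.
  - intros n.
    assert (H := dval_range beta 0 (INR m) (shift n (fun j => INR (eps j))) Hb (Rle_refl 0)
                   (fun j => Hrange (j + n)%nat)).
    unfold Rdiv in *. lra.
Qed.

Lemma Sigma_prefix (beta : R) (m : nat) (x y : R) (n : nat) (eps eps' : nat -> nat) (r : nat -> R) :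
  1 < beta <= INR m + 1 -> r O = x -> (forall j, (eps j <= m)%nat) ->
  (forall n, r (S n) = beta * r n - INR (eps n)) ->
  r n = y -> Sigma beta m y eps' ->
  Sigma beta m x (fun j => if (j <? n)%nat then eps j else eps' (j - n)%nat).
Proof.
  intros Hb H0 Heps Hr Hn HS.
  destruct (Sigma_orbit beta m y eps' ltac:(lra) HS) as (s & Hs0 & Hs & Hsb).
  split.
  { intros j. destruct (j <? n)%nat; [apply Heps|apply HS]. }
  set (q := fun j => if (j <=? n)%nat then r j else s (j - n)%nat).
  assert (Hq0 : q O = x) by exact H0.
  rewrite <- Hq0.
  assert (Hfin : exists M, forall j, (j <= n)%nat -> Rabs (r j) <= M).
  { clear. induction n as [|n [M HM]].
    - exists (Rabs (r O)). intros j Hj. replace j with O by lia. lra.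
    - exists (Rmax M (Rabs (r (S n)))). intros j Hj.
      destruct (Nat.eq_dec j (S n)) as [->|Hne]; [apply Rmax_r|].
      apply Rle_trans with M; [apply HM; lia|apply Rmax_l]. }
  destruct Hfin as [M HM].
  apply (is_series_orbit beta (Rmax M (INR m / (beta - 1)))); [lra| |].
  - intros j. unfold q.
    destruct (Nat.leb_spec (S j) n), (Nat.leb_spec j n), (Nat.ltb_spec j n); try lia.
    + apply Hr.
    + replace j with n by lia.
      replace (S n - n)%nat with 1%nat by lia. rewrite Nat.sub_diag, Hn, <- Hs0. apply Hs.
    + replace (S j - n)%nat with (S (j - n)) by lia. apply Hs.
  - intros j. unfold q. destruct (Nat.leb_spec j n).
    + apply Rle_trans with M; [now apply HM|apply Rmax_l].
    + apply Rle_trans with (INR m / (beta - 1)); [|apply Rmax_r].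
      specialize (Hsb (j - n)%nat). rewrite Rabs_right; lra.
Qed.

(** Changing a digit by one moves the next remainder by one. If the moved remainder stays in [0, M],
    it yields a second expansion, so uniqueness keeps the remainder strictly between M-1 and 1. The
    digit 0 cannot be lowered nor m raised; there the bound is inherited from the previous remainder
    because M >= 1. *)
Lemma W_orbit (beta : R) (m : nat) (x : R) :
  1 < beta <= INR m + 1 -> W beta m x -> exists eps r, r O = x /\ confined_orbit beta m eps r.
Proof.
  intros Hb [Hx (eps & HS & Huniq)].
  assert (HM : INR m / (beta - 1) * (beta - 1) = INR m) by (field; lra).
  assert (Hlow : (INR m + 1 - beta) / (beta - 1) = INR m / (beta - 1) - 1) by (field; lra).
  rewrite Hlow in Hx. clear Hlow.
  set (M := INR m / (beta - 1)) in *.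
  destruct (Sigma_orbit beta m x eps ltac:(lra) HS) as (r & Hr0 & Hr & Hrb).
  fold M in Hrb.
  exists eps, r. split; [assumption|]. split; [apply HS|]. split; [assumption|].
  fold M.
  (* Splicing d and an expansion of the new remainder after the first n digits produces an expansion
     of x whose n-th digit is d. *)
  assert (Halt : forall n d, (d <= m)%nat -> 0 <= beta * r n - INR d <= M -> d = eps n).
  { intros n d Hd Hrd.
    destruct (expansion_exists beta m _ Hb Hrd) as [eps1 HS1].
    assert (HS2 : Sigma beta m (r n) (fun j => match j with O => d | S i => eps1 i end)).
    { destruct (Sigma_orbit beta m _ eps1 ltac:(lra) HS1) as (s & Hs0 & Hs & Hsb).
      split; [intros [|j]; [assumption|apply HS1]|].
      apply (is_series_orbit beta M _ (fun j => match j with O => r n | S i => s i end)); [lra| |].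
      - intros [|j]; [exact Hs0|apply Hs].
      - intros [|j]; [specialize (Hrb n)|specialize (Hsb j); fold M in Hsb]; rewrite Rabs_right; lra. }
    assert (HS3 := Sigma_prefix beta m x (r n) n eps _ r Hb Hr0 (proj1 HS) Hr eq_refl HS2).
    apply Huniq with (j := n) in HS3. cbv beta in HS3.
    rewrite Nat.ltb_irrefl, Nat.sub_diag in HS3. assumption. }
  induction n as [|n IH]; [lra|].
  assert (Heps := proj1 HS n). rewrite Hr.
  split.
  - destruct (Nat.eq_dec (eps n) 0) as [E|E].
    + rewrite E. simpl. nra.
    + destruct (Rlt_dec (M - 1) (beta * r n - INR (eps n))) as [|Hnlt]; [assumption|exfalso].
      assert (Hp : INR (eps n) = INR (eps n - 1) + 1).
      { rewrite <- S_INR. f_equal. lia. }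
      assert (Hrn := Hrb (S n)). rewrite Hr in Hrn.
      assert (H : (eps n - 1)%nat = eps n); [|lia].
      apply Halt; [lia|]. split; lra.
  - destruct (Nat.eq_dec (eps n) m) as [E|E].
    + rewrite E. nra.
    + destruct (Rlt_dec (beta * r n - INR (eps n)) 1) as [|Hnlt]; [assumption|exfalso].
      assert (Hrn := Hrb (S n)). rewrite Hr in Hrn.
      assert (H : S (eps n) = eps n); [|lia].
      apply Halt; [lia|]. rewrite S_INR. split; lra.
Qed.

(** At a first differing digit the next remainders differ by at least 1, so the one inside (M-1, 1)
    pushes the other out of [0, M]. *)
Lemma orbit_W (beta : R) (m : nat) (eps : nat -> nat) (r : nat -> R) :
  1 < beta -> confined_orbit beta m eps r -> W beta m (r O).
Proof.
  intros Hb (Heps & Hr & Hbd).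
  set (M := INR m / (beta - 1)) in *.
  assert (Hlow : (INR m + 1 - beta) / (beta - 1) = M - 1) by (unfold M; field; lra).
  split; [rewrite Hlow; apply Hbd|].
  exists eps. split.
  - split; [assumption|]. apply (is_series_orbit beta (Rmax 1 (1 - M))); [assumption..|].
    intros n. specialize (Hbd n).
    assert (H1 := Rmax_l 1 (1 - M)). assert (H2 := Rmax_r 1 (1 - M)).
    apply Rabs_le. lra.
  - intros eps' HS.
    destruct (Sigma_orbit _ _ _ _ Hb HS) as (s & Hs0 & Hs & Hsb). fold M in Hsb.
    assert (Hdig : forall n, r n = s n -> eps' n = eps n).
    { intros n Hn. specialize (Hsb (S n)). specialize (Hbd (S n)).
      rewrite Hs in Hsb. rewrite Hr, Hn in Hbd.
      destruct (Nat.lt_trichotomy (eps' n) (eps n)) as [H|[H|H]]; [exfalso|assumption|exfalso];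
        apply le_INR in H; rewrite S_INR in H; lra. }
    assert (Hall : forall n, r n = s n).
    { induction n as [|n IH]; [now rewrite Hs0|].
      rewrite Hr, Hs, (Hdig n IH), IH. reflexivity. }
    intros j. now apply Hdig.
Qed.

(** * The Thue-Morse substitution as a renormalization *)

Definition phi (b : nat -> bool) : nat -> bool :=
  fun n => if Nat.even n then b (Nat.div2 n) else negb (b (Nat.div2 n)).

Lemma parity (n : nat) : exists i, n = (2 * i)%nat \/ n = (2 * i + 1)%nat.
Proof. destruct (Nat.Even_or_Odd n) as [[i H]|[i H]]; exists i; auto. Qed.

Lemma even_double (i : nat) : Nat.even (2 * i) = true.
Proof. apply Nat.even_spec. now exists i. Qed.

Lemma even_double_succ (i : nat) : Nat.even (2 * i + 1) = false.
Proof.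
  rewrite <- Nat.negb_odd. replace (Nat.odd (2 * i + 1)) with true; [reflexivity|].
  symmetry. apply Nat.odd_spec. now exists i.
Qed.

Lemma div2_double_succ (i : nat) : Nat.div2 (2 * i + 1) = i.
Proof. replace (2 * i + 1)%nat with (S (2 * i)) by lia. apply Nat.div2_succ_double. Qed.

Lemma phi_even (b : nat -> bool) (i : nat) : phi b (2 * i) = b i.
Proof. unfold phi. now rewrite even_double, Nat.div2_double. Qed.

Lemma phi_odd (b : nat -> bool) (i : nat) : phi b (2 * i + 1) = negb (b i).
Proof. unfold phi. now rewrite even_double_succ, div2_double_succ. Qed.

Lemma phi_unique (b c : nat -> bool) :
  (forall i, b (2 * i)%nat = c i) -> (forall i, b (2 * i + 1)%nat = negb (c i)) -> b = phi c.
Proof.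
  intros He Ho. extensionality n. destruct (parity n) as [i [->| ->]].
  - now rewrite phi_even.
  - now rewrite phi_odd.
Qed.

Lemma phi_shift (b : nat -> bool) (n : nat) : shift (2 * n) (phi b) = phi (shift n b).
Proof.
  apply phi_unique; intros i; unfold shift.
  - replace (2 * i + 2 * n)%nat with (2 * (i + n))%nat by lia. apply phi_even.
  - replace (2 * i + 1 + 2 * n)%nat with (2 * (i + n) + 1)%nat by lia. apply phi_odd.
Qed.

Lemma phi_flip (b : nat -> bool) : flip (phi b) = phi (flip b).
Proof.
  apply phi_unique; intros i; unfold flip.
  - now rewrite phi_even.
  - now rewrite phi_odd.
Qed.

Lemma sqr_gt_2 (beta : R) : 2 < beta -> 2 < beta ^ 2.
Proof. intros Hb. simpl. nra. Qed.

(** The block coding a bit x is worth 1 + (beta-1) x as a digit in base beta^2, and the constant 1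
    sums to 1/(beta^2-1). *)
Lemma bval_phi (beta : R) (b : nat -> bool) :
  2 < beta -> bval beta (phi b) = (beta - 1) * bval (beta ^ 2) b + / (beta ^ 2 - 1).
Proof.
  intros Hb. assert (Hb2 := sqr_gt_2 beta Hb).
  set (r := fun n => (bval beta (shift (2 * n) (phi b)) - / (beta ^ 2 - 1)) / (beta - 1)).
  rewrite (bval_orbit (beta ^ 2) ((1 + / (beta ^ 2 - 1)) / (beta - 1)) b r).
  - unfold r. rewrite Nat.mul_0_r, shift_0. field. split; lra.
  - lra.
  - intros n. unfold r.
    replace (2 * S n)%nat with (S (S (2 * n))) by lia.
    rewrite !bval_shift by lra.
    replace (S (2 * n)) with (2 * n + 1)%nat by lia.
    rewrite phi_even, phi_odd. destruct (b n); simpl; field; lra.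
  - intros n. unfold r.
    assert (H := bval_range beta (shift (2 * n) (phi b)) ltac:(lra)).
    assert (H1 := inv_base_lt_1 beta Hb).
    assert (H2 := inv_base_lt_1 _ Hb2).
    unfold Rdiv. rewrite Rabs_mult, (Rabs_right (/ (beta - 1))) by lra.
    apply Rmult_le_compat_r; [lra|]. apply Rabs_le. lra.
Qed.

(** The bound is the value of (10)^infinity, the largest image under [phi]. *)
Lemma bval_phi_le (beta : R) (b : nat -> bool) : 2 < beta -> bval beta (phi b) <= beta / (beta ^ 2 - 1).
Proof.
  intros Hb. assert (Hb2 := sqr_gt_2 beta Hb). rewrite bval_phi by assumption.
  assert (H := bval_range (beta ^ 2) b ltac:(lra)).
  replace (beta / (beta ^ 2 - 1)) with ((beta - 1) * / (beta ^ 2 - 1) + / (beta ^ 2 - 1))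
    by (field; lra).
  apply Rplus_le_compat_r, Rmult_le_compat_l; lra.
Qed.

Lemma bval_phi_true (beta : R) : 2 < beta -> bval beta (phi (fun _ => true)) = beta / (beta ^ 2 - 1).
Proof.
  intros Hb. assert (Hb2 := sqr_gt_2 beta Hb). rewrite bval_phi by assumption.
  unfold bval. simpl bit. rewrite dval_const by lra. field. lra.
Qed.

Lemma periodic_lt_11 (beta : R) : 2 < beta -> beta / (beta ^ 2 - 1) < / beta + / beta ^ 2.
Proof.
  intros Hb. assert (Hb2 := sqr_gt_2 beta Hb).
  apply Rlt_0_minus.
  replace (/ beta + / beta ^ 2 - beta / (beta ^ 2 - 1))
    with ((beta ^ 2 - beta - 1) * / (beta ^ 2 * (beta ^ 2 - 1))) by (field; lra).
  apply Rmult_lt_0_compat; [simpl; nra|]. apply Rinv_0_lt_compat. nra.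
Qed.

Lemma inv_lt_periodic (beta : R) : 2 < beta -> / beta < beta / (beta ^ 2 - 1).
Proof.
  intros Hb. assert (Hb2 := sqr_gt_2 beta Hb).
  apply Rlt_0_minus.
  replace (beta / (beta ^ 2 - 1) - / beta) with (/ (beta * (beta ^ 2 - 1))) by (field; lra).
  apply Rinv_0_lt_compat. nra.
Qed.

(** * Admissibility and its behaviour under the substitution *)

Definition admissible_at (beta t : R) (b : nat -> bool) (n : nat) : Prop :=
  b n = false -> bval beta (shift (S n) b) < t.

Definition univoque (beta t : R) (b : nat -> bool) : Prop :=
  forall n, admissible_at beta t b n /\ admissible_at beta t (flip b) n.

Lemma univoque_flip (beta t : R) (b : nat -> bool) : univoque beta t b -> univoque beta t (flip b).
Proof. intros H n. rewrite flip_flip. split; apply H. Qed.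

Lemma shift_flip (b : nat -> bool) (n : nat) : shift n (flip b) = flip (shift n b).
Proof. reflexivity. Qed.

Lemma univoque_shift (beta t : R) (b : nat -> bool) (p : nat) :
  univoque beta t b -> univoque beta t (shift p b).
Proof.
  intros H n. destruct (H (n + p)%nat) as [H1 H2]. split; intros E.
  - rewrite shift_shift. now apply H1.
  - rewrite shift_flip, shift_shift. now apply H2.
Qed.

(** The solution t' of (1 + (beta-1) t' + 1/(beta^2-1)) / beta = t. After a 0 at an even position,
    the tail of [phi b] is a 1 followed by the [phi]-image of the next tail of b, which has this
    value when that tail is worth t'. *)
Definition renorm (beta t : R) : R := (beta * t - 1 - / (beta ^ 2 - 1)) / (beta - 1).

Lemma admissible_phi_iff (beta t : R) (b : nat -> bool) (i : nat) :
  2 < beta ->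
  admissible_at beta t (phi b) (2 * i) <-> admissible_at (beta ^ 2) (renorm beta t) b i.
Proof.
  intros Hb. assert (Hb2 := sqr_gt_2 beta Hb). unfold admissible_at.
  rewrite phi_even.
  assert (H : b i = false ->
    (bval beta (shift (S (2 * i)) (phi b)) < t <-> bval (beta ^ 2) (shift (S i) b) < renorm beta t)).
  { intros E.
    assert (HZ : bval beta (shift (S (2 * i)) (phi b)) =
        (1 + ((beta - 1) * bval (beta ^ 2) (shift (S i) b) + / (beta ^ 2 - 1))) / beta).
    { rewrite <- bval_phi, <- phi_shift by assumption.
      replace (2 * S i)%nat with (S (2 * i + 1)) by lia.
      rewrite (bval_shift beta (phi b) (2 * i + 1)), phi_odd, E by lra.
      replace (S (2 * i)) with (2 * i + 1)%nat by lia. simpl bit. field. lra. }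
    assert (Hsub : t - bval beta (shift (S (2 * i)) (phi b)) =
        (beta - 1) / beta * (renorm beta t - bval (beta ^ 2) (shift (S i) b))).
    { rewrite HZ. unfold renorm. field. lra. }
    assert (Hpos : 0 < (beta - 1) / beta) by (apply Rdiv_lt_0_compat; lra).
    split; intros Hlt; nra. }
  tauto.
Qed.

(** The tail after an odd position is again a [phi]-image, hence worth at most (10)^infinity, which
    lies below 11 followed by zeros. Only the even positions carry information. *)
Lemma admissible_phi_odd (beta t : R) (b : nat -> bool) (i : nat) :
  2 < beta -> / beta + / beta ^ 2 <= t -> admissible_at beta t (phi b) (2 * i + 1).
Proof.
  intros Hb Ht _. replace (S (2 * i + 1)) with (2 * S i)%nat by lia. rewrite phi_shift.
  apply Rle_lt_trans with (beta / (beta ^ 2 - 1)); [now apply bval_phi_le|].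
  assert (H := periodic_lt_11 beta Hb). lra.
Qed.

Lemma univoque_phi (beta t : R) (b : nat -> bool) :
  2 < beta -> / beta + / beta ^ 2 <= t ->
  univoque (beta ^ 2) (renorm beta t) b -> univoque beta t (phi b).
Proof.
  intros Hb Ht H n. rewrite phi_flip. destruct (parity n) as [i [->| ->]]; split.
  - apply admissible_phi_iff; [assumption|apply H].
  - apply admissible_phi_iff; [assumption|apply H].
  - now apply admissible_phi_odd.
  - now apply admissible_phi_odd.
Qed.

Lemma univoque_of_phi (beta t : R) (b : nat -> bool) :
  2 < beta -> univoque beta t (phi b) -> univoque (beta ^ 2) (renorm beta t) b.
Proof.
  intros Hb H n. split.
  - apply admissible_phi_iff; [assumption|apply H].
  - apply admissible_phi_iff; [assumption|]. rewrite <- phi_flip. apply H.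
Qed.

(** * The Thue-Morse threshold *)

Definition tm (n : nat) : bool := (thue_morse n =? 1)%nat.

Definition tau (beta : R) : R := bval beta (shift 1 tm).

Lemma tm_aux_fuel (n : nat) : forall f g, (n < f)%nat -> (n < g)%nat -> tm_aux f n = tm_aux g n.
Proof.
  induction n as [n IH] using (well_founded_induction Nat.lt_wf_0).
  intros [|f] [|g] Hf Hg; try lia. simpl. destruct n as [|n]; [reflexivity|].
  assert (Hd : (Nat.div2 (S n) < S n)%nat) by (apply Nat.lt_div2; lia).
  rewrite (IH _ Hd f g) by lia. reflexivity.
Qed.

Lemma thue_morse_le_1 (n : nat) : (thue_morse n <= 1)%nat.
Proof.
  unfold thue_morse. generalize (S n) as f. intros f. revert n.
  induction f as [|f IH]; intros n; cbn [tm_aux]; [lia|].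
  destruct n as [|n]; [lia|]. specialize (IH (Nat.div2 (S n))).
  destruct (Nat.even (S n)); lia.
Qed.

Lemma INR_thue_morse (n : nat) : INR (thue_morse n) = bit (tm n).
Proof.
  assert (H := thue_morse_le_1 n). unfold tm.
  destruct (thue_morse n) as [|[|p]]; simpl; auto; lia.
Qed.

Lemma thue_morse_div2 (n : nat) : thue_morse (S n) =
  if Nat.even (S n) then thue_morse (Nat.div2 (S n)) else (1 - thue_morse (Nat.div2 (S n)))%nat.
Proof.
  assert (Hd : (Nat.div2 (S n) < S n)%nat) by (apply Nat.lt_div2; lia).
  unfold thue_morse at 1.
  change (tm_aux (S (S n)) (S n)) with
    (if Nat.even (S n) then tm_aux (S n) (Nat.div2 (S n))
     else (1 - tm_aux (S n) (Nat.div2 (S n)))%nat).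
  rewrite (tm_aux_fuel (Nat.div2 (S n)) (S n) (S (Nat.div2 (S n)))) by lia. reflexivity.
Qed.

Lemma tm_phi : tm = phi tm.
Proof.
  extensionality n. destruct n as [|n]; [reflexivity|].
  unfold phi, tm at 1. rewrite thue_morse_div2. destruct (Nat.even (S n)); [reflexivity|].
  unfold tm. assert (H := thue_morse_le_1 (Nat.div2 (S n))).
  destruct (thue_morse (Nat.div2 (S n))) as [|[|p]]; auto; lia.
Qed.

(** As [tm] is fixed by [phi], its tail after the first 0 is a 1 followed by the [phi]-image of that
    same tail, which is the configuration defining [renorm]. *)
Lemma renorm_tau (beta : R) : 2 < beta -> renorm beta (tau beta) = tau (beta ^ 2).
Proof.
  intros Hb. assert (Hb2 := sqr_gt_2 beta Hb).
  assert (H : bval beta (shift 2 tm) = (beta - 1) * tau (beta ^ 2) + / (beta ^ 2 - 1)).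
  { unfold tau. rewrite <- bval_phi by assumption. rewrite <- phi_shift, <- tm_phi. reflexivity. }
  assert (H1 := bval_shift beta tm 1 ltac:(lra)).
  rewrite H in H1. change (bit (tm 1)) with 1 in H1.
  unfold renorm, tau at 1. replace (beta * bval beta (shift 1 tm) - 1) with
    ((beta - 1) * tau (beta ^ 2) + / (beta ^ 2 - 1)) by lra.
  field. lra.
Qed.

Lemma renorm_gap (beta t : R) :
  2 < beta -> renorm beta t - tau (beta ^ 2) = beta / (beta - 1) * (t - tau beta).
Proof.
  intros Hb. assert (Hb2 := sqr_gt_2 beta Hb).
  rewrite <- renorm_tau by assumption. unfold renorm. field. lra.
Qed.

(** The factor is 1 + 1/(beta-1) > 1. A fixed lower bound [g] for the gap can thus be carried
    unchanged through an induction on the number of renormalizations. *)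
Lemma renorm_gap_ge (beta t g : R) :
  2 < beta -> 0 <= g <= t - tau beta -> g <= renorm beta t - tau (beta ^ 2).
Proof.
  intros Hb Hg. rewrite renorm_gap by assumption.
  replace (beta / (beta - 1)) with (1 + / (beta - 1)) by (field; lra).
  assert (H := inv_base_lt_1 beta Hb). nra.
Qed.

Lemma renorm_gap_le (beta t g : R) :
  2 < beta -> 0 <= g <= tau beta - t -> g <= tau (beta ^ 2) - renorm beta t.
Proof.
  intros Hb Hg. assert (H1 := renorm_gap beta t Hb).
  replace (beta / (beta - 1)) with (1 + / (beta - 1)) in H1 by (field; lra).
  assert (H := inv_base_lt_1 beta Hb). nra.
Qed.

Lemma tau_ge_11 (beta : R) : 2 < beta -> / beta + / beta ^ 2 <= tau beta.
Proof.
  intros Hb. unfold tau. rewrite bval_unfold, shift_shift by lra.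
  rewrite (bval_unfold beta (shift (1 + 1) tm)), shift_shift by lra.
  change (bit (shift 1 tm 0)) with 1. change (bit (shift (1 + 1) tm 0)) with 1.
  assert (H := bval_range beta (shift (1 + (1 + 1)) tm) ltac:(lra)).
  set (y := bval beta (shift (1 + (1 + 1)) tm)) in *.
  replace ((1 + (1 + y) / beta) / beta) with (/ beta + / beta ^ 2 + y * / beta ^ 2)
    by (field; lra).
  assert (0 <= y * / beta ^ 2).
  { apply Rmult_le_pos; [lra|]. left. apply Rinv_0_lt_compat, pow_lt. lra. }
  lra.
Qed.

Lemma tau_lt (beta : R) : 2 < beta -> tau beta < / (beta - 1).
Proof.
  intros Hb. replace (/ (beta - 1)) with (bval beta (fun _ => true)).
  - apply bval_lex_lt with 2%nat; auto. intros [|[|j]] Hj; auto; lia.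
  - unfold bval. simpl bit. rewrite dval_const; unfold Rdiv; lra.
Qed.

Lemma bval_lt_11 (beta : R) (b : nat -> bool) :
  2 < beta -> b 0%nat = true -> b 1%nat = false -> bval beta b < / beta + / beta ^ 2.
Proof.
  intros Hb H0 H1. rewrite bval_unfold, H0 by lra. simpl bit.
  assert (H := bval_false_lt beta (shift 1 b) Hb H1).
  replace (/ beta + / beta ^ 2) with ((1 + / beta) / beta) by (field; lra).
  unfold Rdiv. apply Rmult_lt_compat_r; [apply Rinv_0_lt_compat; lra|lra].
Qed.

(* If a block [01] is followed by [(10)^l 11], the tail after its [0] is [1 (10)^l 11],
   which exceeds the Thue-Morse tail [1 10 10 01 ...] lexicographically. *)
Lemma no_block_11 (beta t : R) (b : nat -> bool) (n j : nat) :
  2 < beta -> t <= tau beta -> univoque beta t b ->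
  (forall i, (i < j)%nat -> b (n + 2 * i + 1)%nat = negb (b (n + 2 * i)%nat)) ->
  b (n + 2 * j)%nat = true -> b (n + 2 * j + 1)%nat = true ->
  forall i, (i < j)%nat -> b (n + 2 * i)%nat = true.
Proof.
  intros Hb Ht HU Hpair Hj0 Hj1.
  assert (H : forall l i, (i < j)%nat -> (j - i <= l)%nat -> b (n + 2 * i)%nat = true).
  { induction l as [|l IH]; intros i Hi Hl; [lia|].
    assert (Hlater : forall i', (i < i' <= j)%nat -> b (n + 2 * i')%nat = true).
    { intros i' Hi'. destruct (Nat.eq_dec i' j) as [->|Hne]; [assumption|]. apply IH; lia. }
    destruct (b (n + 2 * i)%nat) eqn:E; [reflexivity|exfalso].
    assert (Hlt := proj1 (HU (n + 2 * i)%nat) E).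
    assert (Hp := Hpair i Hi). rewrite E in Hp.
    assert (Hgt : tau beta < bval beta (shift (S (n + 2 * i)) b)); [|lra].
    assert (Hget : forall q r, (q + S (n + 2 * i) = r)%nat ->
               shift (S (n + 2 * i)) b q = b r) by (intros q r <-; reflexivity).
    assert (G0 : shift (S (n + 2 * i)) b 0 = true).
    { rewrite (Hget _ (n + 2 * i + 1)%nat) by lia. exact Hp. }
    assert (G1 : shift (S (n + 2 * i)) b 1 = true).
    { rewrite (Hget _ (n + 2 * (i + 1))%nat) by lia. apply Hlater. lia. }
    (* The Thue-Morse tail starts with 110100. The tail of b starts with 111, 11011 or 110101
       according to whether j is i+1, i+2 or larger, and so exceeds it at index 2, 4 or 5. *)
    destruct (Nat.eq_dec (i + 1) j) as [E1|N1].
    { apply bval_lex_lt with 2%nat; auto.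
      - intros [|[|q]] Hq; [now rewrite G0|now rewrite G1|lia].
      - rewrite (Hget _ (n + 2 * j + 1)%nat) by lia. assumption. }
    assert (G2 : shift (S (n + 2 * i)) b 2 = false).
    { rewrite (Hget _ (n + 2 * (i + 1) + 1)%nat), Hpair, Hlater by lia. reflexivity. }
    assert (G3 : shift (S (n + 2 * i)) b 3 = true).
    { rewrite (Hget _ (n + 2 * (i + 2))%nat) by lia. apply Hlater. lia. }
    destruct (Nat.eq_dec (i + 2) j) as [E2|N2].
    { apply bval_lex_lt with 4%nat; auto.
      - intros [|[|[|[|q]]]] Hq; rewrite ?G0, ?G1, ?G2, ?G3; auto; lia.
      - rewrite (Hget _ (n + 2 * j + 1)%nat) by lia. assumption. }
    assert (G4 : shift (S (n + 2 * i)) b 4 = false).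
    { rewrite (Hget _ (n + 2 * (i + 2) + 1)%nat), Hpair, Hlater by lia. reflexivity. }
    apply bval_lex_lt with 5%nat; auto.
    - intros [|[|[|[|[|q]]]]] Hq; rewrite ?G0, ?G1, ?G2, ?G3, ?G4; auto; lia.
    - rewrite (Hget _ (n + 2 * (i + 3))%nat) by lia. apply Hlater. lia. }
  intros i Hi. apply (H (j - i)%nat); lia.
Qed.

(** Cut b into blocks of two from n on and look at the first block that is 11 or 00. If it is 11,
    all earlier blocks begin with 1, against the initial 01. If it is 00, all earlier blocks begin
    with 0 by the flipped argument, against the second block, which begins with 1. *)
Lemma univoque_aligned (beta t : R) (b : nat -> bool) (n : nat) :
  2 < beta -> t <= tau beta -> univoque beta t b ->
  b n = false -> b (n + 1)%nat = true -> b (n + 2)%nat = true ->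
  exists c, shift n b = phi c.
Proof.
  intros Hb Ht HU H0 H1 H2.
  assert (Hpair : forall j, b (n + 2 * j + 1)%nat = negb (b (n + 2 * j)%nat)).
  { intros j. induction j as [j IH] using (well_founded_induction Nat.lt_wf_0).
    destruct (Bool.bool_dec (b (n + 2 * j + 1)%nat) (negb (b (n + 2 * j)%nat))) as [|Hne];
      [assumption|exfalso].
    destruct (Nat.eq_dec j 0) as [->|Hj0].
    { rewrite Nat.mul_0_r, Nat.add_0_r, H0, H1 in Hne. now apply Hne. }
    destruct (b (n + 2 * j)%nat) eqn:E1, (b (n + 2 * j + 1)%nat) eqn:E2;
      try (now apply Hne).
    - assert (H := no_block_11 beta t b n j Hb Ht HU IH E1 E2 0%nat ltac:(lia)).
      rewrite Nat.mul_0_r, Nat.add_0_r in H. congruence.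
    - destruct (Nat.eq_dec j 1) as [->|Hj1].
      { rewrite Nat.mul_1_r in E1. congruence. }
      assert (H : flip b (n + 2 * 1)%nat = true).
      { apply (no_block_11 beta t (flip b) n j); auto; try lia.
        - now apply univoque_flip.
        - intros i Hi. unfold flip. now rewrite IH.
        - unfold flip. now rewrite E1.
        - unfold flip. now rewrite E2. }
      unfold flip in H. rewrite Nat.mul_1_r, H2 in H. discriminate. }
  exists (fun i => b (n + 2 * i)%nat). apply phi_unique; intros i; unfold shift.
  - f_equal. lia.
  - rewrite <- Hpair. f_equal. lia.
Qed.

(** * Eventual periodicity below the critical threshold *)

Definition eventually_periodic (b : nat -> bool) : Prop :=
  exists p q, (0 < q)%nat /\ forall j, (p <= j)%nat -> b (j + q)%nat = b j.

Lemma eventually_periodic_shift (b : nat -> bool) (n : nat) :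
  eventually_periodic (shift n b) -> eventually_periodic b.
Proof.
  intros (p & q & Hq & H). exists (p + n)%nat, q. split; [assumption|].
  intros j Hj. specialize (H (j - n)%nat ltac:(lia)). unfold shift in H.
  replace (j - n + q + n)%nat with (j + q)%nat in H by lia.
  replace (j - n + n)%nat with j in H by lia. exact H.
Qed.

Lemma eventually_periodic_flip (b : nat -> bool) :
  eventually_periodic (flip b) -> eventually_periodic b.
Proof.
  intros (p & q & Hq & H). exists p, q. split; [assumption|].
  intros j Hj. specialize (H j Hj). unfold flip in H.
  destruct (b (j + q)%nat), (b j); auto; discriminate.
Qed.

Lemma eventually_periodic_phi (b : nat -> bool) :
  eventually_periodic b -> eventually_periodic (phi b).
Proof.
  intros (p & q & Hq & H). exists (2 * p)%nat, (2 * q)%nat. split; [lia|].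
  intros j Hj. destruct (parity j) as [i [->| ->]].
  - replace (2 * i + 2 * q)%nat with (2 * (i + q))%nat by lia. rewrite !phi_even. apply H. lia.
  - replace (2 * i + 1 + 2 * q)%nat with (2 * (i + q) + 1)%nat by lia.
    rewrite !phi_odd. f_equal. apply H. lia.
Qed.

(** The hypothesis excludes the patterns 011 and 100, so b is constant or alternates forever after
    its first change. *)
Lemma eventually_periodic_alternating (b : nat -> bool) :
  (forall n, b n <> b (n + 1)%nat -> b (n + 1)%nat <> b (n + 2)%nat) -> eventually_periodic b.
Proof.
  intros H. destruct (classic (exists n, b n <> b (n + 1)%nat)) as [[n Hn]|Hno].
  - assert (Halt : forall l, b (n + l)%nat <> b (n + l + 1)%nat).
    { induction l as [|l IH]; [now rewrite Nat.add_0_r|].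
      apply H in IH. replace (n + S l)%nat with (n + l + 1)%nat by lia.
      now replace (n + l + 1 + 1)%nat with (n + l + 2)%nat by lia. }
    exists n, 2%nat. split; [lia|]. intros j Hj.
    assert (H1 := Halt (j - n)%nat). assert (H2 := H _ H1).
    replace (n + (j - n))%nat with j in * by lia.
    destruct (b j), (b (j + 1)%nat), (b (j + 2)%nat); congruence.
  - exists 0%nat, 1%nat. split; [lia|]. intros j _.
    destruct (Bool.bool_dec (b (j + 1)%nat) (b j)) as [|Hne]; [assumption|].
    exfalso. apply Hno. exists j. auto.
Qed.

(** A change followed by a repetition is 011 in b or in its flip, and from there on
    [univoque_aligned] undoes one [phi]. *)
Lemma univoque_periodic_or_phi (beta t : R) (b : nat -> bool) :
  2 < beta -> t <= tau beta -> univoque beta t b ->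
  eventually_periodic b \/
  exists n c, (shift n b = phi c \/ shift n (flip b) = phi c) /\
    univoque (beta ^ 2) (renorm beta t) c.
Proof.
  intros Hb Ht HU.
  assert (Hphi : forall b n, univoque beta t b -> b n = false -> b (n + 1)%nat = true ->
     b (n + 2)%nat = true -> exists c, shift n b = phi c /\
       univoque (beta ^ 2) (renorm beta t) c).
  { intros b' n HU' H0 H1 H2.
    destruct (univoque_aligned beta t b' n Hb Ht HU' H0 H1 H2) as [c Hc].
    exists c. split; [assumption|]. apply univoque_of_phi; [assumption|].
    rewrite <- Hc. now apply univoque_shift. }
  destruct (classic (forall n, b n <> b (n + 1)%nat -> b (n + 1)%nat <> b (n + 2)%nat)) as [H|H].
  - left. now apply eventually_periodic_alternating.
  - right. apply not_all_ex_not in H. destruct H as [n H].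
    apply imply_to_and in H. destruct H as [Hne Heq]. apply NNPP in Heq.
    exists n. destruct (b n) eqn:E0, (b (n + 1)%nat) eqn:E1; try congruence.
    + destruct (Hphi (flip b) n) as [c [Hc HUc]].
      * now apply univoque_flip.
      * unfold flip. now rewrite E0.
      * unfold flip. now rewrite E1.
      * unfold flip. now rewrite <- Heq.
      * exists c. auto.
    + destruct (Hphi b n) as [c [Hc HUc]]; auto. exists c. auto.
Qed.

Lemma univoque_pos (beta t : R) (b : nat -> bool) : 1 < beta -> univoque beta t b -> 0 < t.
Proof.
  intros Hb HU. destruct (HU 0%nat) as [H1 H2].
  destruct (b 0%nat) eqn:E.
  - assert (H := bval_range beta (shift 1 (flip b)) Hb).
    assert (bval beta (shift 1 (flip b)) < t); [|lra]. apply H2. unfold flip. now rewrite E.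
  - assert (H := bval_range beta (shift 1 b) Hb).
    assert (bval beta (shift 1 b) < t); [|lra]. now apply H1.
Qed.

(** The left side is the largest value of any bit sequence in the base reached after n
    renormalizations, so it also bounds [tau] there. *)
Lemma iterated_square_large (beta g : R) :
  2 < beta -> 0 < g -> exists n, / (beta ^ (2 ^ n) - 1) < g.
Proof.
  intros Hb Hg.
  destruct (Pow_x_infinity 2 ltac:(rewrite Rabs_right; lra) (1 + / g + 1)) as [n Hn].
  specialize (Hn n (le_n _)). rewrite Rabs_right in Hn by (apply Rle_ge, pow_le; lra).
  exists n.
  assert (Hge : 2 ^ n <= beta ^ (2 ^ n)).
  { apply Rle_trans with (beta ^ n); [apply pow_incr; lra|].
    apply Rle_pow; [lra|]. apply Nat.lt_le_incl, Nat.pow_gt_lin_r. lia. }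
  assert (Hgi : 0 < / g) by now apply Rinv_0_lt_compat.
  rewrite <- (Rinv_inv g). apply Rinv_lt_contravar; [|lra].
  apply Rmult_lt_0_compat; lra.
Qed.

Lemma pow_square (beta : R) (n : nat) : (beta ^ 2) ^ (2 ^ n) = beta ^ (2 ^ S n).
Proof. rewrite <- pow_mult. reflexivity. Qed.

(* Each renormalization keeps the gap [tau beta - t] at least as large while [tau] tends to [0]
   along the squared bases, so the threshold eventually becomes nonpositive. *)
Theorem subcritical_periodic (beta t : R) (b : nat -> bool) :
  2 < beta -> t < tau beta -> univoque beta t b -> eventually_periodic b.
Proof.
  intros Hb Ht HU.
  destruct (iterated_square_large beta (tau beta - t) Hb ltac:(lra)) as [n Hn].
  set (g := tau beta - t) in *.
  assert (Hg : 0 < g <= tau beta - t) by (unfold g; lra). clearbody g. clear Ht.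
  revert beta t b Hb Hn Hg HU.
  induction n as [|n IH]; intros beta t b Hb Hn Hg HU.
  - rewrite pow_1 in Hn. assert (H := tau_lt beta Hb).
    assert (H1 := univoque_pos beta t b ltac:(lra) HU). lra.
  - destruct (univoque_periodic_or_phi beta t b Hb ltac:(lra) HU) as [|(p & c & Hc & HUc)];
      [assumption|].
    assert (Hper : eventually_periodic (phi c)).
    { apply eventually_periodic_phi, (IH (beta ^ 2) (renorm beta t)); auto.
      - now apply sqr_gt_2.
      - now rewrite pow_square.
      - split; [lra|]. apply renorm_gap_le; [assumption|lra]. }
    destruct Hc as [Hc|Hc]; rewrite <- Hc in Hper; apply eventually_periodic_shift in Hper;
      [assumption|]. now apply eventually_periodic_flip.
Qed.

Definition cons_bit (x : bool) (b : nat -> bool) : nat -> bool :=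
  fun n => match n with O => x | S n => b n end.

Lemma shift_cons_bit (x : bool) (b : nat -> bool) (n : nat) : shift (S n) (cons_bit x b) = shift n b.
Proof. extensionality j. unfold shift. rewrite Nat.add_succ_r. reflexivity. Qed.

Lemma bval_cons_bit (beta : R) (x : bool) (b : nat -> bool) :
  1 < beta -> bval beta (cons_bit x b) = (bit x + bval beta b) / beta.
Proof. intros Hb. rewrite bval_unfold, shift_cons_bit, shift_0 by assumption. reflexivity. Qed.

(** * Admissible sequences at and above the critical threshold *)

(** Fuel cuts off the infinite nesting. Each level emits at least one 0 before [phi], and [phi]
    reads only half the position, so position n is settled by n+1 levels. *)
Fixpoint delayed_tm (fuel : nat) (a : nat -> bool) : nat -> bool :=
  match fuel with
  | O => fun _ => false
  | S f => let c := cons_bit false (phi (delayed_tm f (shift 1 a))) in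
           if a O then cons_bit false c else c
  end.

(* The sequence [0^(1+a_0) phi(0^(1+a_1) phi(0^(1+a_2) ...))]. *)
Definition delayed (a : nat -> bool) : nat -> bool := fun n => delayed_tm (S n) a n.

Lemma div2_le (n : nat) : (Nat.div2 n <= n)%nat.
Proof. destruct n; [auto|]. apply Nat.lt_le_incl, Nat.lt_div2. lia. Qed.

Lemma phi_local (b c : nat -> bool) (n : nat) :
  b (Nat.div2 n) = c (Nat.div2 n) -> phi b n = phi c n.
Proof. intros H. unfold phi. now rewrite H. Qed.

Lemma delayed_tm_fuel (f : nat) : forall g a n, (n < f)%nat -> (n < g)%nat ->
  delayed_tm f a n = delayed_tm g a n.
Proof.
  induction f as [|f IH]; intros [|g] a n Hf Hg; try lia. cbn [delayed_tm].
  destruct (a O); destruct n as [|[|n]]; try reflexivity; cbn [cons_bit];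
    apply phi_local, IH; try (assert (H := div2_le n); lia); try (simpl; lia);
    assert (H := div2_le (S n)); lia.
Qed.

Lemma delayed_eq (a : nat -> bool) :
  delayed a = let c := cons_bit false (phi (delayed (shift 1 a))) in
              if a O then cons_bit false c else c.
Proof.
  extensionality n. unfold delayed at 1. cbn [delayed_tm].
  destruct (a O); destruct n as [|[|n]]; try reflexivity; cbn [cons_bit];
    apply phi_local, delayed_tm_fuel;
    assert (H := div2_le n); assert (H' := div2_le (S n)); lia.
Qed.

Lemma delayed_0 (a : nat -> bool) : delayed a 0 = false.
Proof. rewrite delayed_eq. simpl. now destruct (a O). Qed.

Lemma cons_bit_inj (x y : bool) (b c : nat -> bool) : cons_bit x b = cons_bit y c -> b = c.
Proof. intros H. extensionality n. exact (f_equal (fun u => u (S n)) H). Qed.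

Lemma phi_inj (b c : nat -> bool) : phi b = phi c -> b = c.
Proof.
  intros H. extensionality n. assert (E := f_equal (fun u => u (2 * n)%nat) H).
  cbv beta in E. now rewrite !phi_even in E.
Qed.

(** The inner [phi]-image starts with 01, so the whole starts with 001 or 0001, and position 2
    reveals the first delay. *)
Lemma delayed_2 (a : nat -> bool) : delayed a 2 = negb (a O).
Proof.
  assert (H := delayed_0 (shift 1 a)). rewrite delayed_eq. cbv zeta.
  destruct (a O); cbn [cons_bit].
  - exact H.
  - change (negb (delayed (shift 1 a) 0) = true). now rewrite H.
Qed.

Lemma delayed_inj (a a' : nat -> bool) : delayed a = delayed a' -> a = a'.
Proof.
  intros H. extensionality n. revert a a' H.
  induction n as [|n IH]; intros a a' H;
    assert (H0 := f_equal (fun u => u 2%nat) H); cbv beta in H0; rewrite !delayed_2 in H0;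
    apply (f_equal negb) in H0; rewrite !Bool.negb_involutive in H0; [assumption|].
  assert (H1 : shift 1 a n = shift 1 a' n).
  { apply IH. rewrite (delayed_eq a), (delayed_eq a'), H0 in H.
    destruct (a' O); cbv zeta in H; repeat apply cons_bit_inj in H; now apply phi_inj. }
  unfold shift in H1. now rewrite Nat.add_1_r in H1.
Qed.

Lemma admissible_cons_bit_S (beta t : R) (x : bool) (b : nat -> bool) (n : nat) :
  admissible_at beta t b n -> admissible_at beta t (cons_bit x b) (S n).
Proof. intros H E. rewrite shift_cons_bit. now apply H. Qed.

Lemma admissible_cons_false (beta t : R) (b : nat -> bool) :
  bval beta b < t -> admissible_at beta t (cons_bit false b) 0.
Proof. intros H _. now rewrite shift_cons_bit, shift_0. Qed.

Lemma admissible_cons_true (beta t : R) (b : nat -> bool) :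
  admissible_at beta t (cons_bit true b) 0.
Proof. discriminate. Qed.

Lemma flip_cons_bit (x : bool) (b : nat -> bool) :
  flip (cons_bit x b) = cons_bit (negb x) (flip b).
Proof. extensionality n. now destruct n. Qed.

Lemma admissible_phi (beta t : R) (b : nat -> bool) (n : nat) :
  2 < beta -> / beta + / beta ^ 2 <= t ->
  admissible_at (beta ^ 2) (renorm beta t) b (Nat.div2 n) -> admissible_at beta t (phi b) n.
Proof.
  intros Hb Ht H. destruct (parity n) as [i [->| ->]].
  - rewrite Nat.div2_double in H. now apply admissible_phi_iff.
  - now apply admissible_phi_odd.
Qed.

(** Induction on the position, for all bases at once: a position inside the [phi]-image refers to at
    most half of it in base beta^2, where the threshold is again [tau]. At the leading zeros the
    tail either begins with 0 or is a [phi]-image, and both are worth less than 11 followed by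
    zeros. *)
Lemma delayed_univoque (beta : R) (a : nat -> bool) :
  2 < beta -> univoque beta (tau beta) (delayed a).
Proof.
  intros Hb n. revert beta a Hb.
  induction n as [n IH] using (well_founded_induction Nat.lt_wf_0). intros beta a Hb.
  assert (Htau := tau_ge_11 beta Hb).
  set (b := phi (delayed (shift 1 a))).
  assert (Hbt : bval beta b < tau beta).
  { assert (H := bval_phi_le beta (delayed (shift 1 a)) Hb).
    assert (H1 := periodic_lt_11 beta Hb). unfold b. lra. }
  assert (Hlow : forall x, bval beta (cons_bit false x) < tau beta).
  { intros x. assert (H := bval_false_lt beta (cons_bit false x) Hb eq_refl).
    assert (0 < / beta ^ 2) by (apply Rinv_0_lt_compat, pow_lt; lra). lra. }
  assert (Hrec : forall l, (l < n)%nat ->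
    admissible_at beta (tau beta) b l /\ admissible_at beta (tau beta) (flip b) l).
  { intros l Hl. assert (Hd := div2_le l).
    destruct (IH (Nat.div2 l) ltac:(lia) (beta ^ 2) (shift 1 a) (sqr_gt_2 beta Hb)) as [H1 H2].
    rewrite <- renorm_tau in H1, H2 by assumption. unfold b. rewrite phi_flip.
    split; apply admissible_phi; assumption. }
  rewrite delayed_eq. fold b.
  destruct (a O); cbv zeta; rewrite !flip_cons_bit; cbn [negb].
  - destruct n as [|[|n]].
    + split; [apply admissible_cons_false, Hlow|apply admissible_cons_true].
    + split; apply admissible_cons_bit_S;
        [now apply admissible_cons_false|apply admissible_cons_true].
    + split; do 2 apply admissible_cons_bit_S; apply Hrec; lia.
  - destruct n as [|n].
    + split; [now apply admissible_cons_false|apply admissible_cons_true].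
    + split; apply admissible_cons_bit_S; apply Hrec; lia.
Qed.

(** Here [f] is an iterate of [phi] and [B] the correspondingly squared base. The first bit is
    tracked because [point_even] subtracts it and because the odd case needs sequences starting with
    0. *)
Lemma supercritical_affine (beta t : R) :
  2 < beta -> tau beta < t ->
  exists (f : (nat -> bool) -> (nat -> bool)) (B p q : R), 2 < B /\ 0 < q /\
    forall a, univoque beta t (f a) /\ f a 0%nat = a 0%nat /\
      bval beta (f a) = p + q * bval B a.
Proof.
  intros Hb Ht.
  destruct (iterated_square_large beta (t - tau beta) Hb ltac:(lra)) as [n Hn].
  set (g := t - tau beta) in *.
  assert (Hg : 0 < g <= t - tau beta) by (unfold g; lra). clearbody g. clear Ht.
  revert beta t Hb Hn Hg.
  induction n as [|n IH]; intros beta t Hb Hn Hg.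
  (* The gap alone now exceeds the largest value 1/(beta-1), so the threshold excludes nothing. *)
  - rewrite pow_1 in Hn. exists (fun a => a), beta, 0, 1.
    split; [assumption|]. split; [lra|]. intros a. split; [|split; [reflexivity|lra]].
    assert (Htau := bval_range beta (shift 1 tm) ltac:(lra)). fold (tau beta) in Htau.
    intros l. split; intros _.
    + assert (H := bval_range beta (shift (S l) a) ltac:(lra)). lra.
    + assert (H := bval_range beta (shift (S l) (flip a)) ltac:(lra)). lra.
  - destruct (IH (beta ^ 2) (renorm beta t)) as (f & B & p & q & HB & Hq & Hf).
    + now apply sqr_gt_2.
    + now rewrite pow_square.
    + split; [lra|]. apply renorm_gap_ge; [assumption|lra].
    + exists (fun a => phi (f a)), B, ((beta - 1) * p + / (beta ^ 2 - 1)), ((beta - 1) * q).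
      split; [assumption|]. split; [nra|]. intros a. destruct (Hf a) as (HU & H0 & Hv).
      split; [|split; [exact H0|]].
      * apply univoque_phi; [assumption| |assumption].
        assert (H := tau_ge_11 beta Hb). lra.
      * rewrite bval_phi, Hv by assumption. ring.
Qed.

(** The sequences 0^n (10)^infinity, an infinite family that becomes admissible once the threshold
    passes the value of (10)^infinity. *)
Fixpoint padded (n : nat) : nat -> bool :=
  match n with
  | O => phi (fun _ => true)
  | S n => cons_bit false (padded n)
  end.

(** In an alternating sequence the tail after a 0 is always (10)^infinity. The bound on the value is
    carried along because it is the condition at the next 0 put in front. *)
Lemma padded_univoque (beta t : R) (n : nat) :
  2 < beta -> beta / (beta ^ 2 - 1) < t -> univoque beta t (padded n) /\ bval beta (padded n) < t.
Proof.
  intros Hb Ht. assert (Hpos := inv_lt_periodic beta Hb).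
  induction n as [|n [IH1 IH2]].
  - assert (H : forall l, admissible_at beta t (phi (fun _ => true)) l /\
                          admissible_at beta t (phi (fun _ => false)) l).
    { intros l.
      assert (H : forall x, admissible_at beta t (phi (fun _ => x)) l).
      { intros x E. destruct (parity (S l)) as [i [->|Hi]].
        - rewrite phi_shift. eapply Rle_lt_trans; [now apply bval_phi_le|assumption].
        - replace (S l) with (1 + 2 * i)%nat by lia.
          rewrite <- shift_shift, phi_shift.
          replace l with (2 * i)%nat in E by lia. rewrite phi_even in E. rewrite E.
          assert (H1 := bval_shift beta (phi (shift i (fun _ => false))) 0 ltac:(lra)).
          rewrite H1, shift_0.
          change (bit (phi (shift i (fun _ => false)) 0)) with 0.
          rewrite bval_phi by assumption. unfold bval, shift. simpl bit.
          assert (Hb2 := sqr_gt_2 beta Hb).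
          rewrite dval_const by lra.
          replace (beta * ((beta - 1) * (0 / (beta ^ 2 - 1)) + / (beta ^ 2 - 1)) - 0)
            with (beta / (beta ^ 2 - 1)) by (field; lra). assumption. }
      split; apply H. }
    split.
    + intros l. cbn [padded]. rewrite phi_flip. apply H.
    + cbn [padded]. rewrite bval_phi_true; assumption.
  - split.
    + intros [|l]; cbn [padded]; rewrite flip_cons_bit; split.
      * now apply admissible_cons_false.
      * apply admissible_cons_true.
      * apply admissible_cons_bit_S, IH1.
      * apply admissible_cons_bit_S, IH1.
    + assert (H := bval_false_lt beta (padded (S n)) Hb eq_refl). lra.
Qed.

Lemma padded_inj (n n' : nat) : padded n = padded n' -> n = n'.
Proof.
  revert n'. induction n as [|n IH]; intros [|n'] H; auto.
  - apply (f_equal (fun u => u 0%nat)) in H. discriminate.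
  - apply (f_equal (fun u => u 0%nat)) in H. discriminate.
  - f_equal. apply IH. now apply cons_bit_inj in H.
Qed.

(** * Reduction of W to binary sequences *)

(* The thresholds t(beta) for m = 2k+1 and m = 2k, and the points of the interval encoded by a
   binary sequence in the two cases. *)
Definition thr_odd (k : nat) (beta : R) : R := 1 - INR k / (beta - 1).

Definition thr_even (k : nat) (beta : R) : R := thr_odd k beta * (beta / (beta - 1)).

Definition point_odd (k : nat) (beta : R) (b : nat -> bool) : R :=
  INR k / (beta - 1) + bval beta b.

Definition point_even (k : nat) (beta : R) (b : nat -> bool) : R :=
  INR k / (beta - 1) + (beta - 1) * bval beta b - bit (b 0%nat).

(** For m = 2k+1 the remainder is k/(beta-1) plus the value of a tail of b, so the bound concerns
    every tail, whichever bit precedes it. *)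
Definition confined (beta t : R) (b : nat -> bool) : Prop :=
  forall n, bval beta (shift n b) < t /\ bval beta (shift n (flip b)) < t.

Lemma confined_le (beta t t' : R) (b : nat -> bool) :
  t <= t' -> confined beta t b -> confined beta t' b.
Proof. intros Ht H n. destruct (H n). lra. Qed.

Lemma confined_univoque (beta t : R) (b : nat -> bool) : confined beta t b -> univoque beta t b.
Proof. intros H n. split; intros _; apply H. Qed.

(** After a 1 the bound propagates: [y < t] gives [beta * y - 1 < t], because t is at most the fixed
    point 1/(beta-1) of this map. The initial 01 provides the starting bounds for b and its flip. *)
Lemma univoque_confined (beta t : R) (b : nat -> bool) :
  2 < beta -> / beta + / beta ^ 2 <= t <= / (beta - 1) -> univoque beta t b ->
  b 0%nat = false -> b 1%nat = true -> confined beta t b.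
Proof.
  intros Hb [Ht Ht'] HU H0 H1.
  assert (Hstart : bval beta b < t /\ bval beta (flip b) < t).
  { assert (Hpos : 0 < / beta ^ 2) by (apply Rinv_0_lt_compat, pow_lt; lra). split.
    - assert (H := bval_false_lt beta b Hb H0). lra.
    - assert (H : bval beta (flip b) < / beta + / beta ^ 2); [|lra].
      apply bval_lt_11; [assumption|unfold flip; now rewrite H0|unfold flip; now rewrite H1]. }
  assert (Hstep : forall y, y < t -> beta * y - 1 < t).
  { intros y Hy. assert ((beta - 1) * t <= 1); [|nra].
    apply Rmult_le_compat_l with (r := beta - 1) in Ht'; [|lra].
    rewrite Rinv_r in Ht' by lra. exact Ht'. }
  intros n. induction n as [|n [IH1 IH2]]; [now rewrite !shift_0|].
  destruct (HU n) as [HU1 HU2]. split.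
  - destruct (b n) eqn:E; [|now apply HU1].
    rewrite bval_shift, E by lra. now apply Hstep.
  - destruct (flip b n) eqn:E; [|now apply HU2].
    rewrite bval_shift, E by lra. now apply Hstep.
Qed.

Lemma W_odd_intro (beta : R) (k : nat) (b : nat -> bool) :
  1 < beta -> confined beta (thr_odd k beta) b -> W beta (2 * k + 1) (point_odd k beta b).
Proof.
  intros Hb H.
  rewrite <- (shift_0 b).
  apply (orbit_W beta (2 * k + 1) (fun n => k + Nat.b2n (b n))%nat
           (fun n => point_odd k beta (shift n b))); [assumption|].
  split; [|split].
  - intros j. destruct (b j); simpl; lia.
  - intros n. unfold point_odd. rewrite bval_shift by assumption.
    rewrite plus_INR. replace (INR (Nat.b2n (b n))) with (bit (b n)) by now destruct (b n).
    field. lra.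
  - intros n. destruct (H n) as [H1 H2]. rewrite shift_flip, bval_flip in H2 by assumption.
    unfold thr_odd, point_odd in *.
    rewrite plus_INR, mult_INR. simpl INR.
    replace (((1 + 1) * INR k + 1) / (beta - 1)) with
      (INR k / (beta - 1) + INR k / (beta - 1) + / (beta - 1)) by (field; lra).
    lra.
Qed.

Lemma W_odd_elim (beta x : R) (k : nat) :
  2 < beta <= INR (2 * k + 1) + 1 -> thr_odd k beta <= / (beta - 1) ->
  W beta (2 * k + 1) x ->
  exists b, x = point_odd k beta b /\ confined beta (thr_odd k beta) b.
Proof.
  intros Hb Ht HW.
  destruct (W_orbit beta (2 * k + 1) x ltac:(lra) HW) as (eps & r & Hr0 & Heps & Hr & Hbd).
  set (K := INR k / (beta - 1)).
  assert (HKe : K * (beta - 1) = INR k) by (unfold K; field; lra).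
  assert (HM : INR (2 * k + 1) / (beta - 1) = K + K + / (beta - 1)).
  { rewrite plus_INR, mult_INR. simpl INR. unfold K. field. lra. }
  rewrite HM in Hbd. unfold thr_odd in Ht. fold K in Ht.
  assert (Hi := inv_base_lt_1 beta ltac:(lra)).
  assert (Hs : forall n, 0 < r n - K < / (beta - 1)).
  { intros n. specialize (Hbd n). lra. }
  assert (Hbi : (beta - 1) * / (beta - 1) = 1) by (field; lra).
  (* With s_n = r_n - K, the centred digit eps_n - k equals beta s_n - s_(n+1), which lies strictly
     between -1 and 2. *)
  assert (Hdig : forall n, eps n = k \/ eps n = S k).
  { intros n. assert (H1 := Hs n). assert (H2 := Hs (S n)). rewrite Hr in H2.
    assert (Hl : (k - 1 < eps n)%nat \/ (k = 0)%nat).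
    { destruct (Nat.eq_dec k 0) as [|Hk]; [now right|left].
      apply INR_lt. replace (INR (k - 1)) with (INR k - 1); [nra|].
      rewrite minus_INR by lia. reflexivity. }
    assert (Hu : (eps n < S (S k))%nat).
    { apply INR_lt. rewrite !S_INR. nra. }
    lia. }
  set (b := fun n => (eps n =? S k)%nat).
  assert (HE : forall n, INR (eps n) = INR k + bit (b n)).
  { intros n. unfold b. destruct (Hdig n) as [-> | ->].
    - replace (k =? S k)%nat with false by (symmetry; apply Nat.eqb_neq; lia). simpl bit. lra.
    - rewrite Nat.eqb_refl, S_INR. reflexivity. }
  assert (HZ : forall n, bval beta (shift n b) = r n - K).
  { intros n. rewrite (bval_orbit beta 1 (shift n b) (fun j => r (j + n)%nat - K));
      [reflexivity|lra| |].
    - intros j. cbn [Nat.add]. rewrite Hr, HE. unfold shift. lra.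
    - intros j. specialize (Hs (j + n)%nat). rewrite Rabs_right; lra. }
  exists b. split.
  - unfold point_odd. rewrite <- (shift_0 b), HZ, Hr0. unfold K. ring.
  - intros n. rewrite shift_flip, bval_flip, HZ by lra. unfold thr_odd. fold K.
    specialize (Hbd n). lra.
Qed.

(** Let z_n be the value of the n-th tail of b. The centred remainder is (beta-1) z_n - b_n and must
    lie within [thr_odd] of 0. If b_n = 0 it is nonnegative and z_(n+1) = beta z_n, so the bound
    reads z_(n+1) < [thr_even]: this is the origin of the factor beta/(beta-1). The case b_n = 1 is
    dual, since a tail and its flip add up to 1/(beta-1). *)
Lemma W_even_intro (beta : R) (k : nat) (b : nat -> bool) :
  2 < beta -> (1 <= k)%nat -> univoque beta (thr_even k beta) b ->
  W beta (2 * k) (point_even k beta b).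
Proof.
  intros Hb Hk HU.
  rewrite <- (shift_0 b).
  apply (orbit_W beta (2 * k) (fun n => k + Nat.b2n (b (S n)) - Nat.b2n (b n))%nat
           (fun n => point_even k beta (shift n b))); [lra|].
  assert (Hb2n : forall x, INR (Nat.b2n x) = bit x) by (intros []; reflexivity).
  assert (Hi := inv_base_lt_1 beta Hb).
  assert (Hbi : (beta - 1) * / (beta - 1) = 1) by (field; lra).
  split; [|split].
  - intros j. destruct (b (S j)), (b j); simpl; lia.
  - intros n. unfold point_even. rewrite bval_shift by lra.
    rewrite minus_INR by (destruct (b n); simpl; lia). rewrite plus_INR, !Hb2n.
    change (shift (S n) b 0) with (b (S n)). change (shift n b 0) with (b n).
    field. lra.
  - intros n. destruct (HU n) as [H1 H2].
    rewrite mult_INR. simpl INR.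
    replace ((1 + 1) * INR k / (beta - 1)) with (INR k / (beta - 1) + INR k / (beta - 1))
      by (field; lra).
    assert (Hc : forall y, beta * y < thr_even k beta -> (beta - 1) * y < thr_odd k beta).
    { intros y Hy. unfold thr_even in Hy.
      apply Rmult_lt_compat_l with (r := (beta - 1) / beta) in Hy;
        [|apply Rdiv_lt_0_compat; lra].
      replace ((beta - 1) / beta * (beta * y)) with ((beta - 1) * y) in Hy by (field; lra).
      replace ((beta - 1) / beta * (thr_odd k beta * (beta / (beta - 1)))) with (thr_odd k beta)
        in Hy by (field; lra). exact Hy. }
    unfold point_even. change (shift n b 0) with (b n).
    assert (Hr1 := bval_range beta (shift n b) ltac:(lra)).
    assert (Hr2 := bval_range beta (shift n (flip b)) ltac:(lra)).
    assert (Hn := bval_flip beta (shift n b) ltac:(lra)). rewrite <- shift_flip in Hn.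
    unfold admissible_at in H1, H2. rewrite bval_shift in H1, H2 by lra.
    unfold thr_odd in Hc. set (z := bval beta (shift n b)) in *.
    set (z' := bval beta (shift n (flip b))) in *.
    assert (Hz : 0 <= (beta - 1) * z) by (apply Rmult_le_pos; lra).
    assert (Hz' : 0 <= (beta - 1) * z') by (apply Rmult_le_pos; lra).
    assert (Hsum : (beta - 1) * z + (beta - 1) * z' = 1) by (rewrite Hn; lra).
    assert (E2 : flip b n = negb (b n)) by reflexivity.
    rewrite E2 in H2.
    destruct (b n); simpl bit in *; cbn [negb] in *.
    + specialize (H2 eq_refl). simpl bit in H2. specialize (Hc z' ltac:(lra)). lra.
    + specialize (H1 eq_refl). simpl bit in H1. specialize (Hc z ltac:(lra)). lra.
Qed.

(* With centred digits [d_n = eps_n - k] and tails [y_n], one has [|y_n| < 1/beta], so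
   [d_n] lies in [{-1, 0, 1}] and the sign bits [b_n = (y_n < 0)] satisfy
   [d_n = b_(n+1) - b_n]. *)
Lemma W_even_elim (beta x : R) (k : nat) :
  2 < beta <= INR (2 * k) + 1 -> thr_even k beta <= / (beta - 1) ->
  W beta (2 * k) x ->
  exists b, x = point_even k beta b /\ univoque beta (thr_even k beta) b.
Proof.
  intros Hb Ht HW.
  destruct (W_orbit beta (2 * k) x ltac:(lra) HW) as (eps & r & Hr0 & Heps & Hr & Hbd).
  set (K := INR k / (beta - 1)).
  assert (HKe : K * (beta - 1) = INR k) by (unfold K; field; lra).
  assert (HM : INR (2 * k) / (beta - 1) = K + K).
  { rewrite mult_INR. simpl INR. unfold K. field. lra. }
  rewrite HM in Hbd.
  set (c := thr_odd k beta) in *.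
  assert (Hc : c = 1 - K) by reflexivity.
  assert (Hct : thr_even k beta * (beta - 1) = beta * c).
  { unfold thr_even. fold c. field. lra. }
  assert (Hbi : (beta - 1) * / (beta - 1) = 1) by (field; lra).
  assert (Hc1 : beta * c <= 1) by nra.
  set (y := fun n => r n - K).
  assert (Hy : forall n, - c < y n < c).
  { intros n. specialize (Hbd n). unfold y. lra. }
  assert (Hys : forall n, y (S n) = beta * y n - (INR (eps n) - INR k)).
  { intros n. unfold y. rewrite Hr. lra. }
  set (b := fun n => if Rlt_dec (y n) 0 then true else false).
  assert (Hc2 : c < 1) by nra.
  assert (Hd : forall n, INR (eps n) - INR k = bit (b (S n)) - bit (b n)).
  { intros n. assert (H1 := Hy n). assert (H2 := Hy (S n)). assert (H3 := Hys n).
    assert (Hl : (k < S (S (eps n)))%nat).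
    { apply INR_lt. rewrite !S_INR. nra. }
    assert (Hu : (eps n < S (S k))%nat).
    { apply INR_lt. rewrite !S_INR. nra. }
    assert (Hcase : INR (eps n) = INR k - 1 \/ INR (eps n) = INR k \/ INR (eps n) = INR k + 1).
    { assert (H : k = S (eps n) \/ eps n = k \/ eps n = S k) by lia.
      destruct H as [->|[->| ->]]; rewrite ?S_INR; [left|right; left|right; right]; lra. }
    unfold b.
    destruct (Rlt_dec (y n) 0), (Rlt_dec (y (S n)) 0);
      destruct Hcase as [E|[E|E]]; simpl bit; try lra; exfalso; nra. }
  assert (HZ : forall n, (beta - 1) * bval beta (shift n b) = y n + bit (b n)).
  { intros n.
    rewrite (bval_orbit beta 2 (shift n b) (fun j => (y (j + n)%nat + bit (b (j + n)%nat)) / (beta - 1))).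
    - cbn [Nat.add]. field. lra.
    - lra.
    - intros j. cbn [Nat.add]. rewrite Hys, Hd. unfold shift. field. lra.
    - intros j. specialize (Hy (j + n)%nat). assert (H := bit_bounds (b (j + n)%nat)).
      assert (Hi := inv_base_lt_1 beta ltac:(lra)).
      unfold Rdiv. rewrite Rabs_mult, (Rabs_right (/ (beta - 1))) by lra.
      replace 2 with (2 * 1) by ring.
      apply Rmult_le_compat; try lra; [apply Rabs_pos|apply Rabs_le; lra]. }
  exists b. split.
  - unfold point_even. fold K. assert (H := HZ 0%nat). rewrite shift_0 in H. rewrite H.
    unfold y. rewrite Hr0. ring.
  - intros n.
    assert (H1 := HZ n). assert (H3 := Hy n).
    assert (Hflip : (beta - 1) * bval beta (shift n (flip b)) = 1 - (y n + bit (b n))).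
    { rewrite shift_flip, bval_flip, <- H1 by lra. lra. }
    split; intros E; rewrite bval_shift by lra.
    + rewrite E in *. simpl bit in *.
      apply Rmult_lt_reg_l with (beta - 1); [lra|]. nra.
    + rewrite E. unfold flip in E. apply Bool.negb_false_iff in E. rewrite E in *.
      simpl bit in *. apply Rmult_lt_reg_l with (beta - 1); [lra|]. nra.
Qed.

(** * Cardinalities *)

(** The points of A reached by going back and forth from a point outside the image of [h]. On them
    the bijection inverts [g]; everywhere else it is [h]. *)
Inductive chain {T : Type} (A : R -> Prop) (h : T -> R) (g : R -> T) : R -> Prop :=
  | chain_start x : A x -> (forall u, h u <> x) -> chain A h g x
  | chain_next x : chain A h g x -> chain A h g (h (g x)).

(** The cardinality statements ask for a bijective parametrization, while the coding of W supplies
    only an injection in each direction. *)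
Lemma cantor_bernstein {T : Type} (A : R -> Prop) (h : T -> R) (g : R -> T) :
  (forall u, A (h u)) -> (forall u v, h u = h v -> u = v) ->
  (forall x y, A x -> A y -> g x = g y -> x = y) ->
  exists f : T -> R, (forall u v, f u = f v -> u = v) /\ forall y, A y <-> exists u, f u = y.
Proof.
  intros hA hinj ginj.
  assert (HcA : forall x, chain A h g x -> A x) by (intros x []; auto).
  set (hit := fun u x => chain A h g x /\ g x = u).
  set (f := fun u => if excluded_middle_informative (exists x, hit u x)
                     then epsilon (inhabits 0) (hit u) else h u).
  assert (Hf1 : forall x, chain A h g x -> f (g x) = x).
  { intros x Hx. unfold f.
    destruct (excluded_middle_informative _) as [He|Hne].
    - assert (Hs := epsilon_spec (inhabits 0) (hit (g x)) He). destruct Hs as [Hs1 Hs2].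
      apply ginj; auto.
    - exfalso. apply Hne. exists x. split; auto. }
  assert (Hf2 : forall u, (forall x, chain A h g x -> g x <> u) -> f u = h u).
  { intros u Hu. unfold f. destruct (excluded_middle_informative _) as [[x [Hx E]]|]; auto.
    exfalso. now apply (Hu x). }
  assert (Hdec : forall u, (exists x, chain A h g x /\ g x = u) \/ (forall x, chain A h g x -> g x <> u)).
  { intros u. destruct (classic (exists x, chain A h g x /\ g x = u)) as [|H]; [now left|right].
    intros x Hx E. apply H. now exists x. }
  assert (Hmix : forall x v, chain A h g x -> (forall y, chain A h g y -> g y <> v) -> h v <> x).
  { intros x v Hx Hv E. destruct Hx as [x _ Hno|x Hx]; [now apply (Hno v)|].
    apply hinj in E. now apply (Hv x Hx). }
  exists f. split.
  - intros u v E.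
    destruct (Hdec u) as [[x [Hx <-]]|Hu], (Hdec v) as [[x' [Hx' <-]]|Hv].
    + rewrite !Hf1 in E by assumption. now rewrite E.
    + rewrite Hf1, Hf2 in E by assumption. exfalso. now apply (Hmix x v).
    + rewrite Hf2, Hf1 in E by assumption. exfalso. now apply (Hmix x' u).
    + rewrite !Hf2 in E by assumption. now apply hinj.
  - intros y. split.
    + intros Hy. destruct (classic (chain A h g y)) as [Hc|Hc].
      * exists (g y). now apply Hf1.
      * destruct (classic (exists u, h u = y)) as [[u Hu]|Hno].
        -- exists u. rewrite Hf2; [assumption|]. intros x Hx E. apply Hc.
           rewrite <- Hu, <- E. now apply chain_next.
        -- exfalso. apply Hc, chain_start; [assumption|]. intros u Hu. apply Hno. now exists u.
    + intros [u <-]. destruct (Hdec u) as [[x [Hx <-]]|Hu].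
      * rewrite Hf1 by assumption. auto.
      * rewrite Hf2 by assumption. auto.
Qed.

Fixpoint prefix_code (n : nat) (b : nat -> bool) : nat :=
  match n with
  | O => O
  | S n => (Nat.b2n (b O) + 2 * prefix_code n (shift 1 b))%nat
  end.

Lemma prefix_code_inj (n : nat) : forall b c, prefix_code n b = prefix_code n c ->
  forall j, (j < n)%nat -> b j = c j.
Proof.
  induction n as [|n IH]; intros b c H j Hj; [lia|].
  cbn [prefix_code] in H.
  assert (H0 : b O = c O) by (destruct (b O), (c O); simpl in H; auto; lia).
  destruct j as [|j]; [assumption|]. rewrite H0 in H.
  assert (Hs := IH (shift 1 b) (shift 1 c) ltac:(lia) j ltac:(lia)).
  unfold shift in Hs. now rewrite Nat.add_1_r in Hs.
Qed.

(** A preperiod p, a period q and the first p+q bits determine the sequence; together they form one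
    natural number. *)
Lemma eventually_periodic_code : exists code : (nat -> bool) -> nat,
  forall b c, eventually_periodic b -> eventually_periodic c -> code b = code c -> b = c.
Proof.
  set (per := fun (b : nat -> bool) (pq : nat * nat) => (0 < snd pq)%nat /\
                forall j, (fst pq <= j)%nat -> b (j + snd pq)%nat = b j).
  set (pq := fun b : nat -> bool => epsilon (inhabits (0, 0)%nat) (per b)).
  assert (Hpq : forall b, eventually_periodic b -> per b (pq b)).
  { intros b (p & q & Hq & H). apply epsilon_spec. exists (p, q). split; assumption. }
  exists (fun b => Cantor.to_nat
            (Cantor.to_nat (pq b), prefix_code (fst (pq b) + snd (pq b)) b)).
  intros b c Hb Hc E.
  apply (f_equal Cantor.of_nat) in E. rewrite !Cantor.cancel_of_to in E.
  injection E as E1 E2.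
  apply (f_equal Cantor.of_nat) in E1. rewrite !Cantor.cancel_of_to in E1.
  apply Hpq in Hb. apply Hpq in Hc. rewrite <- E1 in E2, Hc. clear E1.
  destruct (pq b) as [p q]. destruct Hb as [Hq Hb]. destruct Hc as [_ Hc]. simpl in *.
  extensionality n. induction n as [n IH] using (well_founded_induction Nat.lt_wf_0).
  destruct (Nat.lt_ge_cases n (p + q)) as [Hn|Hn].
  - now apply (prefix_code_inj (p + q)).
  - replace n with (n - q + q)%nat by lia. rewrite Hb, Hc by lia. apply IH. lia.
Qed.

Lemma choose_code {T : Type} (A : R -> Prop) (P : T -> Prop) (point : T -> R) :
  inhabited T -> (forall x, A x -> exists b, x = point b /\ P b) ->
  exists g : R -> T, (forall x, A x -> P (g x)) /\
    forall x y, A x -> A y -> g x = g y -> x = y.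
Proof.
  intros HT H.
  set (g := fun x => epsilon HT (fun b => x = point b /\ P b)).
  assert (Hg : forall x, A x -> x = point (g x) /\ P (g x)).
  { intros x Hx. apply (epsilon_spec HT (fun b => x = point b /\ P b)), H, Hx. }
  exists g. split; [intros x Hx; now apply Hg|].
  intros x y Hx Hy E. rewrite (proj1 (Hg x Hx)), (proj1 (Hg y Hy)). now rewrite E.
Qed.

Lemma countably_infinite_intro (A : R -> Prop) (point : (nat -> bool) -> R) (h : nat -> R) :
  (forall n, A (h n)) -> (forall n n', h n = h n' -> n = n') ->
  (forall x, A x -> exists b, x = point b /\ eventually_periodic b) ->
  countably_infinite A.
Proof.
  intros hA hinj H.
  destruct (choose_code A eventually_periodic point (inhabits (fun _ => true)) H)
    as (g & Hg & ginj).
  destruct eventually_periodic_code as [code Hcode].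
  apply (cantor_bernstein A h (fun x => code (g x))); auto.
Qed.

Lemma continuum_card_intro (A : R -> Prop) (point : (nat -> bool) -> R) (h : (nat -> bool) -> R) :
  (forall u, A (h u)) -> (forall u v, h u = h v -> u = v) ->
  (forall x, A x -> exists b, x = point b) ->
  continuum_card A.
Proof.
  intros hA hinj H.
  destruct (choose_code A (fun _ => True) point (inhabits (fun _ => true))) as (g & _ & ginj).
  { intros x Hx. destruct (H x Hx) as [b Hb]. now exists b. }
  apply (cantor_bernstein A h g); auto.
Qed.

(** * Hausdorff dimension *)

Definition agree (n : nat) (a b : nat -> bool) : Prop := forall j, (j < n)%nat -> a j = b j.

(** The fair-coin measure of the intersection of two cylinders: one fixes the first n bits of w, the
    other the first l bits of a. *)
Definition cyl_mass (w : nat -> bool) (n : nat) (a : nat -> bool) (l : nat) : R :=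
  if excluded_middle_informative (agree (Nat.min n l) w a) then (/ 2) ^ (Nat.max n l) else 0.

Definition set_bit (a : nat -> bool) (l : nat) (x : bool) : nat -> bool :=
  fun j => if (j =? l)%nat then x else a j.

Lemma set_bit_agree (a : nat -> bool) (l : nat) (x : bool) : agree l (set_bit a l x) a.
Proof.
  intros j Hj. unfold set_bit. destruct (Nat.eqb_spec j l) as [->|]; [lia|reflexivity].
Qed.

Lemma cyl_mass_range (w : nat -> bool) (n : nat) (a : nat -> bool) (l : nat) :
  0 <= cyl_mass w n a l <= (/ 2) ^ n.
Proof.
  unfold cyl_mass. assert (H : forall p, 0 < (/ 2) ^ p) by (intros p; apply pow_lt; lra).
  destruct (excluded_middle_informative _) as [_|_]; [|specialize (H n); lra].
  split; [left; apply H|].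
  replace (Nat.max n l) with (n + (Nat.max n l - n))%nat by lia. rewrite pow_add.
  rewrite <- (Rmult_1_r ((/ 2) ^ n)) at 2. apply Rmult_le_compat_l; [left; apply H|].
  rewrite <- (pow1 (Nat.max n l - n)). apply pow_incr. lra.
Qed.

Lemma cyl_mass_split (w : nat -> bool) (n : nat) (a : nat -> bool) (l : nat) :
  cyl_mass w n a l =
  cyl_mass w n (set_bit a l true) (S l) + cyl_mass w n (set_bit a l false) (S l).
Proof.
  unfold cyl_mass.
  destruct (Nat.le_gt_cases n l) as [Hn|Hn].
  - replace (Nat.min n l) with n by lia. replace (Nat.min n (S l)) with n by lia.
    replace (Nat.max n l) with l by lia. replace (Nat.max n (S l)) with (S l) by lia.
    assert (H : forall x, agree n w (set_bit a l x) <-> agree n w a).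
    { intros x. split; intros H j Hj; rewrite H by assumption.
      - apply set_bit_agree. lia.
      - symmetry. apply set_bit_agree. lia. }
    destruct (excluded_middle_informative (agree n w a)) as [H1|H1],
      (excluded_middle_informative (agree n w (set_bit a l true))) as [H2|H2],
      (excluded_middle_informative (agree n w (set_bit a l false))) as [H3|H3];
      try (exfalso; rewrite H in *; tauto); simpl; lra.
  - replace (Nat.min n l) with l by lia. replace (Nat.min n (S l)) with (S l) by lia.
    replace (Nat.max n l) with n by lia. replace (Nat.max n (S l)) with n by lia.
    assert (H : forall x, agree (S l) w (set_bit a l x) <-> agree l w a /\ w l = x).
    { intros x. split.
      - intros H. split.
        + intros j Hj. rewrite H by lia. now apply set_bit_agree.
        + rewrite H by lia. unfold set_bit. now rewrite Nat.eqb_refl.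
      - intros [H <-] j Hj. unfold set_bit. destruct (Nat.eqb_spec j l) as [->|]; [reflexivity|].
        apply H. lia. }
    destruct (excluded_middle_informative (agree l w a)) as [H1|H1],
      (excluded_middle_informative (agree (S l) w (set_bit a l true))) as [H2|H2],
      (excluded_middle_informative (agree (S l) w (set_bit a l false))) as [H3|H3];
      rewrite H in H2, H3; destruct (w l); try (exfalso; intuition congruence); lra.
Qed.

(* Always descend into a half whose share of the total cylinder mass is below its own measure:
   the limit point cannot lie in any of the cylinders. *)
Lemma cylinders_miss (w : nat -> nat -> bool) (n : nat -> nat) :
  ex_series (fun i => (/ 2) ^ n i) -> Series (fun i => (/ 2) ^ n i) < 1 ->
  exists a, forall i, ~ agree (n i) (w i) a.
Proof.
  intros Hex Hlt.
  assert (Hexm : forall a l, ex_series (fun i => cyl_mass (w i) (n i) a l)).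
  { intros a l. apply (ex_series_le (K := R_AbsRing) (V := R_CompleteNormedModule))
      with (fun i => (/ 2) ^ n i); [|assumption].
    intros i. change (Rabs (cyl_mass (w i) (n i) a l) <= (/ 2) ^ n i).
    assert (H := cyl_mass_range (w i) (n i) a l). rewrite Rabs_right; lra. }
  set (mu := fun a l => Series (fun i => cyl_mass (w i) (n i) a l)).
  assert (Hsplit : forall a l, mu a l = mu (set_bit a l true) (S l) + mu (set_bit a l false) (S l)).
  { intros a l. unfold mu. rewrite <- Series_plus by apply Hexm.
    apply Series_ext. intros i. apply cyl_mass_split. }
  assert (Hge : forall a l i, cyl_mass (w i) (n i) a l <= mu a l).
  { intros a l i.
    assert (Hp : forall j, 0 <= cyl_mass (w j) (n j) a l) by (intros j; apply cyl_mass_range).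
    apply Rle_trans with (sum_n (fun j => cyl_mass (w j) (n j) a l) i).
    - destruct i as [|i]; [rewrite sum_O; lra|]. rewrite sum_Sn. unfold plus; simpl.
      assert (H : 0 <= sum_n (fun j => cyl_mass (w j) (n j) a l) i); [|lra].
      clear -Hp. induction i as [|i IH]; [rewrite sum_O; apply Hp|].
      rewrite sum_Sn. unfold plus; simpl. specialize (Hp (S i)). lra.
    - apply (is_lim_seq_incr_compare (sum_n (fun j => cyl_mass (w j) (n j) a l))).
      + apply Series_correct, Hexm.
      + intros j. rewrite sum_Sn. unfold plus; simpl. specialize (Hp (S j)). lra. }
  assert (Hagree : forall a b l, agree l a b -> mu a l = mu b l).
  { intros a b l H. apply Series_ext. intros i. unfold cyl_mass.
    assert (E : agree (Nat.min (n i) l) (w i) a <-> agree (Nat.min (n i) l) (w i) b).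
    { split; intros G j Hj; rewrite G by assumption; [|symmetry]; apply H; lia. }
    destruct (excluded_middle_informative _) as [H1|H1],
      (excluded_middle_informative _) as [H2|H2]; tauto. }
  set (pick := fun l a => set_bit a l
                 (if Rlt_dec (mu (set_bit a l true) (S l)) ((/ 2) ^ S l) then true else false)).
  set (p := nat_rect (fun _ => nat -> bool) (fun _ => false) pick).
  assert (HpS : forall l, p (S l) = pick l (p l)) by reflexivity.
  assert (Hp : forall l, mu (p l) l < (/ 2) ^ l).
  { induction l as [|l IH].
    - simpl. unfold mu. rewrite (Series_ext _ (fun i => (/ 2) ^ n i)); [assumption|].
      intros i. unfold cyl_mass. rewrite Nat.min_0_r, Nat.max_0_r.
      destruct (excluded_middle_informative _) as [|H]; [reflexivity|].
      exfalso. apply H. intros j Hj. lia.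
    - rewrite HpS. unfold pick. destruct (Rlt_dec _ _) as [|Hnlt]; [assumption|].
      rewrite Hsplit in IH. simpl in *. lra. }
  set (a := fun j => p (S j) j).
  assert (Hpa : forall l, agree l (p l) a).
  { assert (H : forall d j, p (S j + d)%nat j = a j).
    { induction d as [|d IH]; intros j; [now rewrite Nat.add_0_r|].
      replace (S j + S d)%nat with (S (S j + d)) by lia. rewrite HpS. unfold pick.
      rewrite set_bit_agree by lia. apply IH. }
    intros l j Hj. rewrite <- (H (l - S j)%nat j). f_equal. lia. }
  exists a. intros i Hi.
  (* If a lay in cylinder i, then at level n_i this cylinder alone would contribute 2^(-n_i) to a
     total kept below 2^(-n_i). *)
  assert (H1 := Hge (p (n i)) (n i) i). assert (H2 := Hp (n i)).
  unfold cyl_mass in H1. rewrite Nat.min_id, Nat.max_id in H1.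
  destruct (excluded_middle_informative _) as [_|H]; [lra|].
  apply H. intros j Hj. rewrite Hi by assumption. symmetry. now apply Hpa.
Qed.

Lemma Rbar_lub_upper (E : Rbar -> Prop) (x : Rbar) : E x -> Rbar_le x (Rbar_lub E).
Proof. exact (proj1 (proj2_sig (Rbar_ex_lub E)) x). Qed.

Lemma Rbar_glb_greatest (E : Rbar -> Prop) (x : Rbar) :
  (forall y, E y -> Rbar_le x y) -> Rbar_le x (Rbar_glb E).
Proof. exact (proj2 (proj2_sig (Rbar_ex_glb E)) x). Qed.

Lemma sumNN_bounded (f : nat -> R) (c : R) :
  (forall i, 0 <= f i) -> Rbar_lt (sumNN f) (Finite c) ->
  ex_series f /\ Series f <= c.
Proof.
  intros Hf Hlt.
  assert (Hs : forall n, sum_n f n <= c).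
  { intros n. rewrite sum_n_Reals.
    assert (H : Rbar_le (Finite (sum_f_R0 f n)) (sumNN f)).
    { apply Rbar_lub_upper. now exists n. }
    assert (H1 := Rbar_lt_le _ _ (Rbar_le_lt_trans _ _ _ H Hlt)). exact H1. }
  assert (Hinc : forall n, sum_n f n <= sum_n f (S n)).
  { intros n. rewrite sum_Sn. unfold plus; simpl. specialize (Hf (S n)). lra. }
  assert (Hfin := ex_finite_lim_seq_incr (sum_n f) c Hinc Hs).
  assert (Hex : ex_series f).
  { destruct Hfin as [l Hl]. exists l. exact Hl. }
  split; [assumption|].
  assert (H := is_lim_seq_le (sum_n f) (fun _ => c) (Series f) c Hs
                 (Series_correct f Hex) (is_lim_seq_const c)).
  exact H.
Qed.

Lemma diam_ge (U : R -> Prop) (x y d : R) :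
  U x -> U y -> Rbar_le (diam U) (Finite d) ->
  Rabs (x - y) <= real (diam U).
Proof.
  intros Hx Hy Hd.
  assert (H : Rbar_le (Finite (Rabs (x - y))) (diam U)).
  { apply Rbar_lub_upper. right. exists x, y. auto. }
  destruct (diam U) as [u| |]; simpl in *; tauto.
Qed.

Lemma diam_pos (U : R -> Prop) (d : R) :
  Rbar_le (diam U) (Finite d) -> 0 <= real (diam U) <= d.
Proof.
  intros Hd.
  assert (H : Rbar_le (Finite 0) (diam U)).
  { apply Rbar_lub_upper. now left. }
  destruct (diam U) as [u| |]; simpl in *; try tauto.
Qed.

(** Sequences with different first bits are at least 1 - 1/(B-1) = (B-2)/(B-1) apart after
    multiplication by B; each further common bit shrinks the scale by B. *)
Lemma bval_separation (B : R) (a b : nat -> bool) (n : nat) :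
  2 < B -> Rabs (bval B a - bval B b) < (B - 2) / (B - 1) * (/ B) ^ n -> agree n a b.
Proof.
  intros HB. revert a b. induction n as [|n IH]; intros a b H j Hj; [lia|].
  assert (Hab : B * (bval B a - bval B b) =
      bit (a O) - bit (b O) + (bval B (shift 1 a) - bval B (shift 1 b))).
  { assert (H1 := bval_shift B a 0 ltac:(lra)). assert (H2 := bval_shift B b 0 ltac:(lra)).
    rewrite shift_0 in H1, H2. lra. }
  assert (Hpow : 0 < (/ B) ^ n <= 1).
  { split; [apply pow_lt, Rinv_0_lt_compat; lra|].
    rewrite <- (pow1 n). apply pow_incr. split; [left; apply Rinv_0_lt_compat; lra|].
    rewrite <- Rinv_1. apply Rinv_le_contravar; lra. }
  assert (Hsc : Rabs (B * (bval B a - bval B b)) < (B - 2) / (B - 1) * (/ B) ^ n).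
  { rewrite Rabs_mult, (Rabs_right B) by lra.
    apply Rmult_lt_compat_l with (r := B) in H; [|lra].
    replace (B * ((B - 2) / (B - 1) * (/ B) ^ S n)) with ((B - 2) / (B - 1) * (/ B) ^ n) in H
      by (simpl; field; lra). exact H. }
  assert (H0 : a O = b O).
  { assert (Hlt : Rabs (B * (bval B a - bval B b)) < (B - 2) / (B - 1)).
    { assert (0 < (B - 2) / (B - 1)) by (apply Rdiv_lt_0_compat; lra). nra. }
    replace ((B - 2) / (B - 1)) with (1 - / (B - 1)) in Hlt by (field; lra).
    rewrite Hab in Hlt. apply Rabs_def2 in Hlt.
    assert (H1 := bval_range B (shift 1 a) ltac:(lra)).
    assert (H2 := bval_range B (shift 1 b) ltac:(lra)).
    destruct (a O), (b O); simpl bit in Hlt; auto; lra. }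
  destruct j as [|j]; [assumption|].
  rewrite Hab, H0 in Hsc.
  replace (bit (b O) - bit (b O) + (bval B (shift 1 a) - bval B (shift 1 b)))
    with (bval B (shift 1 a) - bval B (shift 1 b)) in Hsc by ring.
  assert (E := IH _ _ Hsc j ltac:(lia)). unfold shift in E. now rewrite Nat.add_1_r in E.
Qed.

Lemma geometric_scale (B c d : R) :
  1 < B -> 0 < d < c -> exists n, c * (/ B) ^ S n <= d < c * (/ B) ^ n.
Proof.
  intros HB Hd.
  assert (Hex : exists n, c * (/ B) ^ n <= d).
  { destruct (pow_lt_1_zero (/ B)) with (y := d / c) as [N HN].
    - rewrite Rabs_right; [|left; apply Rinv_0_lt_compat; lra].
      rewrite <- Rinv_1. apply Rinv_lt_contravar; lra.
    - apply Rdiv_lt_0_compat; lra.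
    - exists N. specialize (HN N (le_n _)).
      rewrite Rabs_right in HN by (apply Rle_ge, pow_le; left; apply Rinv_0_lt_compat; lra).
      apply Rmult_lt_compat_l with (r := c) in HN; [|lra].
      replace (c * (d / c)) with d in HN by (field; lra). lra. }
  destruct Hex as [N HN]. induction N as [|N IH]; [simpl in HN; lra|].
  destruct (Rle_dec (c * (/ B) ^ N) d) as [Hle|Hgt]; [now apply IH|].
  exists N. lra.
Qed.

Lemma Series_half_pow : is_series (fun i => (/ 2) ^ (i + 3)) (/ 4).
Proof.
  apply (is_series_ext (fun i => (/ 2) ^ 3 * (/ 2) ^ i)).
  - intros i. change (Rmult ((/ 2) ^ 3) ((/ 2) ^ i) = (/ 2) ^ (i + 3)). rewrite pow_add. ring.
  - replace (/ 4) with ((/ 2) ^ 3 * / (1 - / 2)) by (simpl; field).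
    apply (is_series_scal_l ((/ 2) ^ 3) (fun i => (/ 2) ^ i)).
    apply is_series_geom. rewrite Rabs_right; lra.
Qed.

(* With [s0 = ln 2 / ln B], a set of diameter [d ~ q B^(-n)] meets the Cantor set in a single
   level-[n] cylinder, of measure [2^(-n) ~ d^s0]; sets of diameter [0] are given cylinders of
   total measure [1/4]. A cover of small [s]-weight would thus miss a point. *)
Theorem cantor_image_dim_pos (A : R -> Prop) (B p q : R) :
  2 < B -> 0 < q -> (forall a, A (p + q * bval B a)) ->
  Rbar_lt (Finite 0) (hausdorff_dim A).
Proof.
  intros HB Hq HA.
  set (s0 := ln 2 / ln B).
  assert (Hln2 : 0 < ln 2) by (rewrite <- ln_1; apply ln_increasing; lra).
  assert (HlnB : 0 < ln B) by (rewrite <- ln_1; apply ln_increasing; lra).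
  assert (Hs0 : 0 < s0) by (apply Rdiv_lt_0_compat; assumption).
  apply Rbar_lt_le_trans with (Finite s0); [exact Hs0|].
  apply Rbar_glb_greatest. intros v (s & Hs & Hmeas & ->).
  destruct (Rlt_le_dec s s0) as [Hlt|Hge]; [exfalso|exact Hge].
  set (gam := q * ((B - 2) / (B - 1))).
  assert (Hgam : 0 < gam) by (apply Rmult_lt_0_compat; [assumption|apply Rdiv_lt_0_compat; lra]).
  (* At most 1, so that lowering the exponent from s0 to s does not lower powers of a diameter;
     below [gam], so that every positive diameter fits a scale [gam * (/ B) ^ n]. *)
  set (delta := Rmin 1 (gam / 2)).
  assert (Hdelta : 0 < delta /\ delta <= 1 /\ delta < gam).
  { unfold delta. assert (H1 := Rmin_l 1 (gam / 2)). assert (H2 := Rmin_r 1 (gam / 2)).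
    split; [apply Rmin_glb_lt; lra|lra]. }
  (* Chosen so that 2 / [gam]^s0 times [kap] is 1/4: with the 1/4 reserved for diameter 0 the
     cylinders have total measure at most 1/2. *)
  set (kap := Rpower gam s0 / 8).
  assert (Hpg : 0 < Rpower gam s0) by apply exp_pos.
  assert (Hkap : 0 < kap) by (unfold kap; lra).
  assert (Hcover : exists U : nat -> R -> Prop, (forall x, A x -> exists i, U i x) /\
            (forall i, Rbar_le (diam (U i)) (Finite delta)) /\
            Rbar_lt (sumNN (fun i => pw (real (diam (U i))) s)) (Finite kap)).
  { apply NNPP. intros Hno.
    assert (H : Rbar_le (Finite kap) (hausdorff_delta s delta A)).
    { apply Rbar_glb_greatest. intros v (U & HU1 & HU2 & ->).
      apply Rbar_not_lt_le. intros Hl. apply Hno. now exists U. }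
    assert (H1 : Rbar_le (hausdorff_delta s delta A) (hausdorff_measure s A)).
    { apply Rbar_lub_upper. exists delta. split; [apply Hdelta|reflexivity]. }
    rewrite Hmeas in H1. assert (H2 := Rbar_le_trans _ _ _ H H1). simpl in H2. lra. }
  destruct Hcover as (U & Hcov & Hdiam & Hsum).
  set (D := fun i => real (diam (U i))).
  assert (HD : forall i, 0 <= D i <= delta) by (intros i; apply diam_pos, Hdiam).
  assert (Hpw : forall i, 0 <= pw (D i) s).
  { intros i. unfold pw. destruct (Rle_dec _ _); [lra|]. left. apply exp_pos. }
  apply sumNN_bounded in Hsum; [|exact Hpw]. destruct Hsum as [Hex Hsum].
  change (ex_series (fun i => pw (D i) s)) in Hex.
  change (Series (fun i => pw (D i) s) <= kap) in Hsum.
  assert (Hn : exists n : nat -> nat, forall i,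
            D i < gam * (/ B) ^ n i /\
            (/ 2) ^ n i <= 2 / Rpower gam s0 * pw (D i) s + (/ 2) ^ (i + 3)).
  { apply (functional_choice (fun i n => D i < gam * (/ B) ^ n /\
       (/ 2) ^ n <= 2 / Rpower gam s0 * pw (D i) s + (/ 2) ^ (i + 3))).
    intros i. specialize (HD i). unfold pw. destruct (Rle_dec (D i) 0) as [H0|H0].
    - exists (i + 3)%nat. replace (D i) with 0 by lra. split; [|lra].
      apply Rmult_lt_0_compat; [assumption|]. apply pow_lt, Rinv_0_lt_compat. lra.
    - destruct (geometric_scale B gam (D i)) as [n [Hn1 Hn2]]; [lra|lra|].
      exists n. split; [assumption|].
      assert (Hpos : 0 < (/ 2) ^ (i + 3)) by (apply pow_lt; lra).
      assert (Hmain : Rpower gam s0 * (/ 2) ^ S n <= Rpower (D i) s).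
      { apply Rle_trans with (Rpower (D i) s0).
        - replace ((/ 2) ^ S n) with (Rpower ((/ B) ^ S n) s0).
          + rewrite Rpower_mult_distr; [|assumption|apply pow_lt, Rinv_0_lt_compat; lra].
            apply Rle_Rpower_l; [lra|]. split; [|assumption].
            apply Rmult_lt_0_compat; [assumption|]. apply pow_lt, Rinv_0_lt_compat; lra.
          (* This is the defining property of s0: B^s0 = 2. *)
          + rewrite <- !Rpower_pow by (try apply Rinv_0_lt_compat; lra).
            rewrite Rpower_mult. unfold Rpower. f_equal.
            rewrite !ln_Rinv by lra. unfold s0. field. lra.
        - unfold Rpower. apply Rnot_lt_le. intros Hexp. apply exp_lt_inv in Hexp.
          assert (Hl : ln (D i) <= 0).
          { rewrite <- ln_1. apply ln_le; lra. }
          nra. }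
      apply Rle_trans with (2 / Rpower gam s0 * Rpower (D i) s); [|lra].
      apply Rmult_le_reg_l with (Rpower gam s0 / 2); [lra|].
      replace (Rpower gam s0 / 2 * (2 / Rpower gam s0 * Rpower (D i) s)) with (Rpower (D i) s)
        by (field; lra).
      simpl in Hmain. lra. }
  destruct Hn as [n Hn].
  assert (Hmeets : exists w : nat -> nat -> bool, forall i a, U i (p + q * bval B a) ->
            agree (n i) (w i) a).
  { apply (functional_choice (fun i w => forall a, U i (p + q * bval B a) -> agree (n i) w a)).
    intros i. destruct (classic (exists a, U i (p + q * bval B a))) as [[w Hw]|Hno].
    - exists w. intros a Ha. apply (bval_separation B); [assumption|].
      assert (H := diam_ge (U i) _ _ delta Hw Ha (Hdiam i)). fold (D i) in H.
      replace (p + q * bval B w - (p + q * bval B a)) with (q * (bval B w - bval B a)) in H by ring.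
      rewrite Rabs_mult, (Rabs_right q) in H by lra.
      apply Rmult_lt_reg_l with q; [assumption|]. destruct (Hn i) as [Hi _].
      unfold gam in Hi. lra.
    - exists (fun _ => false). intros a Ha. exfalso. apply Hno. now exists a. }
  destruct Hmeets as [w Hw].
  assert (Hex2 : is_series (fun i => 2 / Rpower gam s0 * pw (D i) s + (/ 2) ^ (i + 3))
                   (2 / Rpower gam s0 * Series (fun i => pw (D i) s) + / 4)).
  { apply (is_series_plus (fun i => 2 / Rpower gam s0 * pw (D i) s) (fun i => (/ 2) ^ (i + 3))).
    - apply (is_series_scal_l (2 / Rpower gam s0) (fun i => pw (D i) s)).
      now apply Series_correct.
    - apply Series_half_pow. }
  assert (Hpn : forall i, 0 <= (/ 2) ^ n i <= 2 / Rpower gam s0 * pw (D i) s + (/ 2) ^ (i + 3)).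
  { intros i. split; [apply pow_le; lra|apply Hn]. }
  destruct (cylinders_miss w n) as [a Ha].
  - apply (ex_series_le (K := R_AbsRing) (V := R_CompleteNormedModule))
      with (fun i => 2 / Rpower gam s0 * pw (D i) s + (/ 2) ^ (i + 3)).
    + intros i. change (Rabs ((/ 2) ^ n i) <= 2 / Rpower gam s0 * pw (D i) s + (/ 2) ^ (i + 3)).
      rewrite Rabs_right; [apply Hpn|apply Rle_ge, Hpn].
    + eexists. exact Hex2.
  - apply Rle_lt_trans with (Series (fun i => 2 / Rpower gam s0 * pw (D i) s + (/ 2) ^ (i + 3))).
    + apply Series_le; [exact Hpn|eexists; exact Hex2].
    + rewrite (is_series_unique _ _ Hex2).
      assert (H : 2 / Rpower gam s0 * Series (fun i => pw (D i) s) <= 2 / Rpower gam s0 * kap).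
      { apply Rmult_le_compat_l; [|assumption]. left. apply Rdiv_lt_0_compat; lra. }
      replace (2 / Rpower gam s0 * kap) with (/ 4) in H by (unfold kap; field; lra). lra.
  - destruct (Hcov _ (HA a)) as [i Hi]. now apply (Ha i), Hw.
Qed.

(** * The four parameter ranges *)

(** Thresholds increase with beta while [tau] does not, so the sign of their difference is that of
    beta - beta_c. *)
Lemma thr_odd_lt (k : nat) (beta beta' : R) :
  (1 <= k)%nat -> 1 < beta -> beta < beta' -> thr_odd k beta < thr_odd k beta'.
Proof.
  intros Hk Hb Hlt. unfold thr_odd.
  assert (HK : 1 <= INR k) by (change 1 with (INR 1); now apply le_INR).
  assert (H : / (beta' - 1) < / (beta - 1)) by (apply Rinv_lt_contravar; nra).
  unfold Rdiv. nra.
Qed.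

Lemma thr_even_lt (k : nat) (beta beta' : R) :
  (1 <= k)%nat -> 1 < beta -> beta < beta' -> thr_even k beta < thr_even k beta'.
Proof.
  intros Hk Hb Hlt. unfold thr_even, thr_odd.
  assert (HK : 1 <= INR k) by (change 1 with (INR 1); now apply le_INR).
  assert (H : / (beta' - 1) < / (beta - 1)) by (apply Rinv_lt_contravar; nra).
  assert (H0 : 0 < / (beta' - 1)) by (apply Rinv_0_lt_compat; lra).
  replace (beta / (beta - 1)) with (1 + / (beta - 1)) by (field; lra).
  replace (beta' / (beta' - 1)) with (1 + / (beta' - 1)) by (field; lra).
  unfold Rdiv. set (u := / (beta - 1)) in *. set (v := / (beta' - 1)) in *.
  assert (Hd : 0 < (u - v) * (INR k - 1 + INR k * (u + v))) by (apply Rmult_lt_0_compat; nra).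
  lra.
Qed.

Lemma tau_antitone (beta beta' : R) : 1 < beta -> beta <= beta' -> tau beta' <= tau beta.
Proof. apply bval_antitone. Qed.

Lemma tau_pos (beta : R) : 1 < beta -> 0 < tau beta.
Proof.
  intros Hb. assert (H := bval_true_ge beta (shift 1 tm) Hb eq_refl).
  assert (0 < / beta) by (apply Rinv_0_lt_compat; lra). unfold tau. lra.
Qed.

Lemma thr_odd_pos (k : nat) (beta : R) : 1 < beta -> 0 < thr_odd k beta <-> INR k + 1 < beta.
Proof.
  intros Hb. unfold thr_odd.
  assert (H : (1 - INR k / (beta - 1)) * (beta - 1) = beta - 1 - INR k) by (field; lra).
  split; intros; nra.
Qed.

Lemma thr_even_pos (k : nat) (beta : R) : 1 < beta -> 0 < thr_even k beta <-> INR k + 1 < beta.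
Proof.
  intros Hb. rewrite <- thr_odd_pos by assumption. unfold thr_even.
  assert (0 < beta / (beta - 1)) by (apply Rdiv_lt_0_compat; lra). split; intros; nra.
Qed.

Lemma is_beta_c_odd (k : nat) (bc : R) :
  is_beta_c (2 * k + 1) bc -> 1 < bc /\ thr_odd k bc = tau bc.
Proof.
  intros [Hb Hs]. split; [assumption|].
  apply is_series_unique in Hs.
  assert (HV : dval bc (fun j => lam (2 * k + 1) (S j)) = INR k / (bc - 1) + tau bc).
  { unfold tau.
    rewrite (dval_orbit bc (INR k / (bc - 1) + / (bc - 1)) _
               (fun n => INR k / (bc - 1) + bval bc (shift n (shift 1 tm)))).
    - now rewrite shift_0.
    - assumption.
    - intros n. unfold lam. rewrite even_double_succ, div2_double_succ, INR_thue_morse.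
      rewrite bval_shift by assumption. unfold shift. rewrite Nat.add_1_r. field. lra.
    - intros n. assert (H := bval_range bc (shift n (shift 1 tm)) Hb).
      assert (0 <= INR k / (bc - 1)).
      { apply Rmult_le_pos; [apply pos_INR|]. left. apply Rinv_0_lt_compat. lra. }
      rewrite Rabs_right; lra. }
  unfold dval in HV. rewrite HV in Hs. unfold thr_odd. lra.
Qed.

(** The digits are differences of consecutive Thue-Morse bits shifted by k, so the series is
    k/(beta-1) + tau - tau/beta, the last term being the value of the full sequence with its leading
    0. *)
Lemma is_beta_c_even (k : nat) (bc : R) :
  is_beta_c (2 * k) bc -> 1 < bc /\ thr_even k bc = tau bc.
Proof.
  intros [Hb Hs]. split; [assumption|].
  apply is_series_unique in Hs.
  assert (HV : dval bc (fun j => lam (2 * k) (S j)) =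
                 INR k / (bc - 1) + tau bc - bval bc tm).
  { unfold tau.
    rewrite (dval_orbit bc (INR k / (bc - 1) + / (bc - 1)) _
               (fun n => INR k / (bc - 1) + bval bc (shift (S n) tm) - bval bc (shift n tm))).
    - now rewrite shift_0.
    - assumption.
    - intros n. unfold lam. rewrite even_double, Nat.div2_double, !INR_thue_morse.
      replace (S n - 1)%nat with n by lia.
      rewrite !bval_shift by assumption. field. lra.
    - intros n. assert (H := bval_range bc (shift (S n) tm) Hb).
      assert (H' := bval_range bc (shift n tm) Hb).
      assert (0 <= INR k / (bc - 1)).
      { apply Rmult_le_pos; [apply pos_INR|]. left. apply Rinv_0_lt_compat. lra. }
      apply Rabs_le. lra. }
  assert (H0 : bval bc tm = tau bc / bc).
  { rewrite bval_unfold by assumption. change (bit (tm 0)) with 0. unfold tau. field. lra. }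
  unfold dval in HV. rewrite HV, H0 in Hs.
  unfold thr_even, thr_odd.
  replace (1 - INR k / (bc - 1)) with (tau bc - tau bc / bc) by lra. field. lra.
Qed.

(** Applied at beta_c, where the threshold is [tau]: the resulting beta_c < k+2 places it below
    m+1. *)
Lemma bound_of_thr_odd (k : nat) (beta : R) :
  1 < beta -> thr_odd k beta < / (beta - 1) -> beta < INR k + 2.
Proof.
  intros Hb H. unfold thr_odd in H.
  apply Rmult_lt_compat_r with (r := beta - 1) in H; [|lra].
  replace ((1 - INR k / (beta - 1)) * (beta - 1)) with (beta - 1 - INR k) in H by (field; lra).
  rewrite Rinv_l in H by lra. lra.
Qed.

Lemma bound_of_thr_even (k : nat) (beta : R) :
  1 < beta -> thr_even k beta < / (beta - 1) -> beta < INR k + 2.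
Proof.
  intros Hb H. unfold thr_even, thr_odd in H.
  apply Rmult_lt_compat_r with (r := beta - 1) in H; [|lra].
  replace ((1 - INR k / (beta - 1)) * (beta / (beta - 1)) * (beta - 1))
    with (beta * (1 - INR k / (beta - 1))) in H by (field; lra).
  rewrite Rinv_l in H by lra.
  assert (H1 : INR k / (beta - 1) * (beta - 1) = INR k) by (field; lra).
  set (K := INR k / (beta - 1)) in *. nra.
Qed.

(** * Rigidity under small thresholds *)

Lemma constant_of_no_change (b : nat -> bool) :
  (forall n, b (S n) = b n) -> b = fun _ => b 0%nat.
Proof. intros H. extensionality n. induction n as [|n IH]; [reflexivity|]. now rewrite H. Qed.

(** Let z be the value from the 1 of a pattern 01. The two conditions give z < t and 1 + 1/(beta-1)
    - beta z < t, hence 1 + 1/(beta-1) < (beta+1) t. The value of (10)^infinity is where equality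
    holds. *)
Lemma univoque_no_rise (beta t : R) (b : nat -> bool) (n : nat) :
  2 < beta -> t <= beta / (beta ^ 2 - 1) -> univoque beta t b ->
  b n = false -> b (S n) = false.
Proof.
  intros Hb Ht HU E0. destruct (b (S n)) eqn:E1; [exfalso|reflexivity].
  assert (H1 := proj1 (HU n) E0).
  assert (H2 := proj2 (HU (S n))). unfold admissible_at, flip at 1 in H2.
  rewrite E1 in H2. specialize (H2 eq_refl).
  rewrite shift_flip, bval_flip, bval_shift, E1 in H2 by lra. simpl bit in H2.
  set (z := bval beta (shift (S n) b)) in *.
  assert (Hb2 := sqr_gt_2 beta Hb).
  assert (H3 : (beta + 1) * (beta / (beta ^ 2 - 1)) = 1 + / (beta - 1)) by (field; nra).
  nra.
Qed.

Lemma univoque_constant (beta t : R) (b : nat -> bool) :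
  2 < beta -> t <= beta / (beta ^ 2 - 1) -> univoque beta t b -> b = fun _ => b 0%nat.
Proof.
  intros Hb Ht HU. apply constant_of_no_change. intros n. destruct (b n) eqn:E.
  - assert (H := univoque_no_rise beta t (flip b) n Hb Ht (univoque_flip _ _ _ HU)).
    unfold flip in H. rewrite E in H. apply Bool.negb_false_iff, H. reflexivity.
  - now apply (univoque_no_rise beta t).
Qed.

(* The value of [(1100)^infinity]. *)
Definition double_value (beta : R) : R := beta ^ 2 / ((beta ^ 2 + 1) * (beta - 1)).

(** Removing a leading 11 and flipping acts on values as a decreasing map. It fixes [double_value],
    since (1100)^infinity is 11 followed by its own flip. A value below this fixed point is thus
    sent above it, and so above t. *)
Lemma confined_no_11 (beta t : R) (b : nat -> bool) (n : nat) :
  2 < beta -> t <= double_value beta -> confined beta t b -> b n = true -> b (S n) = false.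
Proof.
  intros Hb Ht HC E0. destruct (b (S n)) eqn:E1; [exfalso|reflexivity].
  destruct (HC n) as [H1 _]. destruct (HC (S (S n))) as [_ H2].
  rewrite shift_flip, bval_flip, !bval_shift, E0, E1 in H2 by lra. simpl bit in H2.
  set (z := bval beta (shift n b)) in *.
  assert (H3 : / (beta - 1) - (beta * (beta * double_value beta - 1) - 1) = double_value beta).
  { unfold double_value. field. split; nra. }
  nra.
Qed.

Lemma confined_alternating (beta t : R) (b : nat -> bool) :
  2 < beta -> t <= double_value beta -> confined beta t b -> b = phi (fun _ => b 0%nat).
Proof.
  intros Hb Ht HC.
  assert (Hstep : forall n, b (S n) = negb (b n)).
  { intros n. destruct (b n) eqn:E; simpl.
    - now apply (confined_no_11 beta t).
    - assert (HC' : confined beta t (flip b)).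
      { intros l. rewrite flip_flip. destruct (HC l). now split. }
      assert (H := confined_no_11 beta t (flip b) n Hb Ht HC').
      unfold flip in H. rewrite E in H. apply Bool.negb_false_iff, H. reflexivity. }
  assert (He : forall i, b (2 * i)%nat = b 0%nat).
  { induction i as [|i IH]; [reflexivity|].
    replace (2 * S i)%nat with (S (S (2 * i))) by lia.
    now rewrite !Hstep, Bool.negb_involutive. }
  apply phi_unique; [assumption|]. intros i. rewrite Nat.add_1_r, Hstep. now rewrite He.
Qed.

Lemma bval_const (beta : R) (x : bool) : 1 < beta -> bval beta (fun _ => x) = bit x / (beta - 1).
Proof. apply dval_const. Qed.

Lemma shift_const (n : nat) (x : bool) : shift n (fun _ => x) = fun _ => x.
Proof. reflexivity. Qed.

Lemma confined_alternating_intro (beta t : R) (x : bool) :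
  2 < beta -> beta / (beta ^ 2 - 1) < t -> confined beta t (phi (fun _ => x)).
Proof.
  intros Hb Ht.
  assert (H : forall y n, bval beta (shift n (phi (fun _ => y))) < t).
  { intros y n.
    assert (Heq : exists y', shift n (phi (fun _ => y)) = phi (fun _ => y')).
    { destruct (parity n) as [i [->| ->]].
      - exists y. now rewrite phi_shift.
      - exists (negb y). apply phi_unique; intros j; unfold shift.
        + replace (2 * j + (2 * i + 1))%nat with (2 * (i + j) + 1)%nat by lia. apply phi_odd.
        + replace (2 * j + 1 + (2 * i + 1))%nat with (2 * (i + j + 1))%nat by lia.
          rewrite phi_even. now destruct y. }
    destruct Heq as [y' ->]. eapply Rle_lt_trans; [now apply bval_phi_le|assumption]. }
  intros n. split; [apply H|]. rewrite phi_flip. apply (H (negb x)).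
Qed.

(** * Cardinality and dimension of W for each parity *)

Lemma W_even_card_1 (k : nat) (beta : R) :
  (1 <= k)%nat -> INR k + 1 < beta -> thr_even k beta <= beta / (beta ^ 2 - 1) ->
  beta <= INR (2 * k) + 1 -> card_eq1 (W beta (2 * k)).
Proof.
  intros Hk Hb Ht Hm.
  assert (HK : 1 <= INR k) by (change 1 with (INR 1); now apply le_INR).
  assert (Hb2 : 2 < beta) by lra.
  assert (Hp := periodic_lt_11 beta Hb2).
  assert (Hti := tau_lt beta Hb2). assert (Hta := tau_ge_11 beta Hb2).
  exists (INR k / (beta - 1)). intros y. split.
  - intros HW. apply W_even_elim in HW; [|lra|lra]. destruct HW as (b & -> & HU).
    (* Both constant sequences encode the digits k, k, k, ..., hence the same point. *)
    apply univoque_constant in HU; [|assumption..]. rewrite HU.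
    unfold point_even. rewrite bval_const by lra. field. lra.
  - intros ->.
    replace (INR k / (beta - 1)) with (point_even k beta (fun _ => false)).
    + apply W_even_intro; [assumption..|]. intros n.
      assert (Hpos : 0 < thr_even k beta) by (apply thr_even_pos; lra).
      split; [intros _|discriminate]. rewrite shift_const, bval_const by lra. simpl bit.
      unfold Rdiv. lra.
    + unfold point_even. rewrite bval_const by lra. simpl bit. field. lra.
Qed.

Lemma W_odd_card_2 (k : nat) (beta : R) :
  2 < beta -> beta / (beta ^ 2 - 1) < thr_odd k beta <= double_value beta ->
  beta <= INR (2 * k + 1) + 1 -> card_eq2 (W beta (2 * k + 1)).
Proof.
  intros Hb Ht Hm.
  assert (Hd : double_value beta < / (beta - 1)).
  { unfold double_value. apply Rlt_0_minus.
    replace (/ (beta - 1) - beta ^ 2 / ((beta ^ 2 + 1) * (beta - 1)))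
      with (/ ((beta ^ 2 + 1) * (beta - 1))) by (field; split; nra).
    apply Rinv_0_lt_compat. nra. }
  exists (point_odd k beta (phi (fun _ => true))), (point_odd k beta (phi (fun _ => false))).
  split.
  - unfold point_odd. intros E. apply Rplus_eq_reg_l, bval_inj in E; [|assumption].
    apply (f_equal (fun u => u 0%nat)) in E. discriminate.
  - intros y. split.
    + intros HW. apply W_odd_elim in HW; [|lra|lra]. destruct HW as (b & -> & HC).
      apply confined_alternating in HC; [|lra..]. rewrite HC.
      destruct (b 0%nat); auto.
    + intros [->| ->]; apply W_odd_intro; try lra; apply confined_alternating_intro; lra.
Qed.

Lemma W_even_countable (k : nat) (beta : R) :
  (1 <= k)%nat -> 2 < beta <= INR (2 * k) + 1 ->
  beta / (beta ^ 2 - 1) < thr_even k beta < tau beta -> countably_infinite (W beta (2 * k)).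
Proof.
  intros Hk Hb Ht. assert (Hti := tau_lt beta ltac:(lra)).
  (* The 0 in front fixes the first bit, which [padded 0] does not share with the others;
     [point_even] is then injective on the family. *)
  apply (countably_infinite_intro _ (point_even k beta)
           (fun n => point_even k beta (cons_bit false (padded n)))).
  - intros n. apply W_even_intro; [lra|assumption|]. apply (padded_univoque _ _ (S n)); lra.
  - intros n n' E. unfold point_even in E. cbn [cons_bit] in E.
    assert (E1 : bval beta (cons_bit false (padded n)) = bval beta (cons_bit false (padded n'))).
    { apply Rmult_eq_reg_l with (beta - 1); lra. }
    apply bval_inj in E1; [|lra]. apply cons_bit_inj in E1. now apply padded_inj.
  - intros x HW. apply W_even_elim in HW; [|lra|lra]. destruct HW as (b & -> & HU).
    exists b. split; [reflexivity|]. apply subcritical_periodic in HU; auto; lra.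
Qed.

(** 0(1100)^infinity is the [phi]-image of 0(10)^infinity. The odd case at this threshold is thus
    the even case at (10)^infinity in base beta^2. *)
Lemma renorm_double_value (beta : R) :
  2 < beta -> renorm beta (double_value beta) = beta ^ 2 / ((beta ^ 2) ^ 2 - 1).
Proof.
  intros Hb. unfold renorm, double_value. assert (Hb2 := sqr_gt_2 beta Hb).
  assert (Hb4 : (beta ^ 2) ^ 2 - 1 = (beta - 1) * (beta + 1) * (beta ^ 2 + 1)) by ring.
  rewrite Hb4. replace (beta ^ 2 - 1) with ((beta - 1) * (beta + 1)) by ring.
  field. repeat split; nra.
Qed.

Lemma renorm_lt (beta t t' : R) : 1 < beta -> t < t' -> renorm beta t < renorm beta t'.
Proof.
  intros Hb Ht. unfold renorm, Rdiv. apply Rmult_lt_compat_r; [apply Rinv_0_lt_compat; lra|]. nra.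
Qed.

Lemma double_value_ge_11 (beta : R) : 2 < beta -> / beta + / beta ^ 2 <= double_value beta.
Proof.
  intros Hb. unfold double_value. apply Rlt_le, Rlt_0_minus.
  assert (Hb2 := sqr_gt_2 beta Hb).
  replace (beta ^ 2 / ((beta ^ 2 + 1) * (beta - 1)) - (/ beta + / beta ^ 2))
    with (/ (beta ^ 2 * ((beta ^ 2 + 1) * (beta - 1)))) by (field; repeat split; nra).
  apply Rinv_0_lt_compat. repeat apply Rmult_lt_0_compat; nra.
Qed.

(** The [phi]-image of a sequence starting with 0 starts with 01, as [univoque_confined] requires.
    Through this the odd case reuses the admissible families of base beta^2. *)
Lemma confined_phi (beta t : R) (b : nat -> bool) :
  2 < beta -> / beta + / beta ^ 2 <= t <= / (beta - 1) -> b 0%nat = false ->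
  univoque (beta ^ 2) (renorm beta t) b -> confined beta t (phi b).
Proof.
  intros Hb Ht H0 HU. apply univoque_confined; [assumption..| | |].
  - apply univoque_phi; [assumption|lra|assumption].
  - exact H0.
  - change (negb (b 0%nat) = true). now rewrite H0.
Qed.

Lemma W_odd_countable (k : nat) (beta : R) :
  2 < beta <= INR (2 * k + 1) + 1 ->
  double_value beta < thr_odd k beta < tau beta -> countably_infinite (W beta (2 * k + 1)).
Proof.
  intros Hb Ht. assert (Hti := tau_lt beta ltac:(lra)).
  assert (Hd := double_value_ge_11 beta ltac:(lra)).
  assert (Hr := renorm_lt beta _ _ ltac:(lra) (proj1 Ht)).
  rewrite renorm_double_value in Hr by lra.
  apply (countably_infinite_intro _ (point_odd k beta)
           (fun n => point_odd k beta (phi (cons_bit false (padded n))))).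
  - intros n. apply W_odd_intro; [lra|]. apply confined_phi; [lra|lra|reflexivity|].
    apply (padded_univoque _ _ (S n)); [|assumption]. apply sqr_gt_2. lra.
  - intros n n' E. unfold point_odd in E. apply Rplus_eq_reg_l, bval_inj in E; [|lra].
    apply phi_inj, cons_bit_inj in E. now apply padded_inj.
  - intros x HW. apply W_odd_elim in HW; [|lra|lra]. destruct HW as (b & -> & HC).
    exists b. split; [reflexivity|]. apply confined_univoque, subcritical_periodic in HC; auto; lra.
Qed.

Lemma W_even_continuum (k : nat) (beta : R) :
  (1 <= k)%nat -> 2 < beta <= INR (2 * k) + 1 -> thr_even k beta = tau beta ->
  continuum_card (W beta (2 * k)).
Proof.
  intros Hk Hb Ht. assert (Hti := tau_lt beta ltac:(lra)).
  apply (continuum_card_intro _ (point_even k beta) (fun a => point_even k beta (delayed a))).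
  - intros a. apply W_even_intro; [lra|assumption|]. rewrite Ht. apply delayed_univoque. lra.
  - intros a a' E. unfold point_even in E. rewrite !delayed_0 in E.
    assert (E1 : bval beta (delayed a) = bval beta (delayed a')).
    { apply Rmult_eq_reg_l with (beta - 1); lra. }
    apply bval_inj in E1; [|lra]. now apply delayed_inj.
  - intros x HW. apply W_even_elim in HW; [|lra|lra]. destruct HW as (b & -> & _). now exists b.
Qed.

Lemma W_odd_continuum (k : nat) (beta : R) :
  2 < beta <= INR (2 * k + 1) + 1 -> thr_odd k beta = tau beta ->
  continuum_card (W beta (2 * k + 1)).
Proof.
  intros Hb Ht. assert (Hti := tau_lt beta ltac:(lra)). assert (Htg := tau_ge_11 beta ltac:(lra)).
  apply (continuum_card_intro _ (point_odd k beta) (fun a => point_odd k beta (phi (delayed a)))).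
  - intros a. apply W_odd_intro; [lra|]. apply confined_phi; [lra|lra|apply delayed_0|].
    rewrite Ht, renorm_tau by lra. apply delayed_univoque, sqr_gt_2. lra.
  - intros a a' E. unfold point_odd in E. apply Rplus_eq_reg_l, bval_inj in E; [|lra].
    now apply delayed_inj, phi_inj.
  - intros x HW. apply W_odd_elim in HW; [|lra|lra]. destruct HW as (b & -> & _). now exists b.
Qed.

Lemma W_even_dim_pos (k : nat) (beta : R) :
  (1 <= k)%nat -> 2 < beta -> tau beta < thr_even k beta ->
  Rbar_lt (Finite 0) (hausdorff_dim (W beta (2 * k))).
Proof.
  intros Hk Hb Ht.
  destruct (supercritical_affine beta _ Hb Ht) as (f & B & p & q & HB & Hq & Hf).
  (* The factor 1/B comes from a 0 put in front of a, which fixes the bit that [point_even]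
     subtracts. *)
  apply (cantor_image_dim_pos _ B (INR k / (beta - 1) + (beta - 1) * p) ((beta - 1) * (q / B)));
    [assumption| |].
  - apply Rmult_lt_0_compat; [lra|]. apply Rdiv_lt_0_compat; lra.
  - intros a. destruct (Hf (cons_bit false a)) as (HU & H0 & Hv).
    replace (INR k / (beta - 1) + (beta - 1) * p + (beta - 1) * (q / B) * bval B a)
      with (point_even k beta (f (cons_bit false a))); [now apply W_even_intro|].
    unfold point_even. rewrite H0, Hv, bval_cons_bit by lra. simpl bit. field. lra.
Qed.

Lemma W_odd_dim_pos (k : nat) (beta : R) :
  2 < beta -> tau beta < thr_odd k beta ->
  Rbar_lt (Finite 0) (hausdorff_dim (W beta (2 * k + 1))).
Proof.
  intros Hb Ht.
  assert (Hti := tau_lt beta Hb). assert (Htg := tau_ge_11 beta Hb).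
  (* For large beta the threshold may exceed 1/(beta-1), beyond the range of [confined_phi]. The
     smaller threshold is still supercritical because tau < 1/(beta-1). *)
  set (t := Rmin (thr_odd k beta) (/ (beta - 1))).
  assert (Ht1 : tau beta < t) by (apply Rmin_glb_lt; assumption).
  assert (Ht2 : t <= thr_odd k beta) by apply Rmin_l.
  assert (Ht3 : t <= / (beta - 1)) by apply Rmin_r.
  assert (Hr := renorm_lt beta _ _ ltac:(lra) Ht1). rewrite renorm_tau in Hr by assumption.
  destruct (supercritical_affine (beta ^ 2) _ (sqr_gt_2 beta Hb) Hr)
    as (f & B & p & q & HB & Hq & Hf).
  apply (cantor_image_dim_pos _ B
           (INR k / (beta - 1) + (beta - 1) * p + / (beta ^ 2 - 1)) ((beta - 1) * (q / B)));
    [assumption| |].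
  - apply Rmult_lt_0_compat; [lra|]. apply Rdiv_lt_0_compat; lra.
  - intros a. destruct (Hf (cons_bit false a)) as (HU & H0 & Hv).
    replace (INR k / (beta - 1) + (beta - 1) * p + / (beta ^ 2 - 1) +
             (beta - 1) * (q / B) * bval B a)
      with (point_odd k beta (phi (f (cons_bit false a)))).
    + apply W_odd_intro; [lra|]. apply confined_le with t; [assumption|].
      apply confined_phi; [assumption|lra|exact H0|assumption].
    + unfold point_odd. rewrite bval_phi, Hv, bval_cons_bit by lra. simpl bit.
      assert (Hb2 := sqr_gt_2 beta Hb). field. lra.
Qed.

(** * Threshold comparisons as polynomial inequalities in beta *)

Lemma thr_even_le_periodic (k : nat) (beta : R) :
  2 < beta -> thr_even k beta <= beta / (beta ^ 2 - 1) <->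
              beta ^ 2 - (INR k + 1) * beta - INR k <= 0.
Proof.
  intros Hb. assert (Hb2 := sqr_gt_2 beta Hb).
  assert (H : (thr_even k beta - beta / (beta ^ 2 - 1)) * ((beta - 1) * (beta ^ 2 - 1)) =
              beta * (beta ^ 2 - (INR k + 1) * beta - INR k)).
  { unfold thr_even, thr_odd. field. lra. }
  assert (Hp : 0 < (beta - 1) * (beta ^ 2 - 1)) by (apply Rmult_lt_0_compat; lra).
  split; intros; nra.
Qed.

Lemma thr_odd_le_double (k : nat) (beta : R) :
  1 < beta -> thr_odd k beta <= double_value beta <-> cubic_odd k beta <= 0.
Proof.
  intros Hb.
  assert (Hb2 : 0 < beta ^ 2 + 1) by nra.
  assert (H : (thr_odd k beta - double_value beta) * ((beta - 1) * (beta ^ 2 + 1)) =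
              cubic_odd k beta).
  { unfold thr_odd, double_value, cubic_odd. field. lra. }
  assert (Hp : 0 < (beta - 1) * (beta ^ 2 + 1)) by (apply Rmult_lt_0_compat; lra).
  split; intros; nra.
Qed.

Lemma periodic_lt_thr_odd (k : nat) (beta : R) :
  1 < beta -> 0 < beta ^ 2 - (INR k + 1) * beta - (INR k + 1) ->
  beta / (beta ^ 2 - 1) < thr_odd k beta.
Proof.
  intros Hb Hpos. apply Rlt_0_minus.
  replace (thr_odd k beta - beta / (beta ^ 2 - 1))
    with ((beta ^ 2 - (INR k + 1) * beta - (INR k + 1)) * / (beta ^ 2 - 1)).
  - apply Rmult_lt_0_compat; [assumption|]. apply Rinv_0_lt_compat. nra.
  - unfold thr_odd. field. split; nra.
Qed.

(** The cubic is (x - (k+2)) (x^2+1) + 1, positive at k+3. A nonpositive value to the left forces a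
    root in between, to be played against maximality of beta_f. *)
Lemma cubic_odd_root_above (k : nat) (x : R) :
  x <= INR k + 3 -> cubic_odd k x <= 0 -> exists y, x <= y /\ cubic_odd k y = 0.
Proof.
  intros Hx Hle.
  assert (HK := pos_INR k).
  assert (Hend : 0 < cubic_odd k (INR k + 3)) by (unfold cubic_odd; nra).
  destruct (Req_dec (cubic_odd k x) 0) as [E|Hne]; [exists x; split; [lra|assumption]|].
  destruct (IVT (cubic_odd k) x (INR k + 3)) as [y [Hy1 Hy2]].
  - unfold cubic_odd. reg.
  - destruct (Req_dec x (INR k + 3)) as [E|Hn]; [rewrite E in Hle; lra|lra].
  - lra.
  - assumption.
  - exists y. split; [lra|assumption].
Qed.

Lemma beta_f_odd_bounds (k : nat) (bf : R) :
  (1 <= k)%nat -> is_beta_f_odd k bf -> 2 < bf < INR k + 3.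
Proof.
  intros Hk [Hroot Hmax].
  assert (HK : 1 <= INR k) by (change 1 with (INR 1); now apply le_INR).
  split.
  - assert (H2 : cubic_odd k 2 < 0) by (unfold cubic_odd; lra).
    destruct (cubic_odd_root_above k 2) as [y [Hy1 Hy2]]; [lra|lra|].
    destruct (Req_dec y 2) as [->|Hne]; [lra|]. specialize (Hmax y Hy2). lra.
  - unfold cubic_odd in Hroot. apply Rnot_le_lt. intros H. nra.
Qed.

Lemma cubic_odd_pos (k : nat) (bf beta : R) :
  (1 <= k)%nat -> is_beta_f_odd k bf -> bf < beta -> 0 < cubic_odd k beta.
Proof.
  intros Hk Hbf Hlt. destruct (Rle_dec beta (INR k + 3)) as [Hle|Hgt].
  - apply Rnot_le_lt. intros Hc.
    destruct (cubic_odd_root_above k beta Hle Hc) as [y [Hy1 Hy2]].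
    destruct Hbf as [_ Hmax]. specialize (Hmax y Hy2). lra.
  - unfold cubic_odd. assert (HK := pos_INR k). nra.
Qed.

(** With v = k+2-bf the root equation reads v (bf^2+1) = 1. Subtracting it, the cubic at beta is
    -(bf-beta) (beta^2+1 - v (bf+beta)), and v (bf+beta) <= 2 v bf <= v (bf^2+1) = 1. *)
Lemma cubic_odd_nonpos (k : nat) (bf beta : R) :
  is_beta_f_odd k bf -> INR k + 1 < beta <= bf -> cubic_odd k beta <= 0.
Proof.
  intros [Hroot _] Hb. assert (HK := pos_INR k).
  assert (H : forall x, cubic_odd k x = (x - (INR k + 2)) * (x ^ 2 + 1) + 1)
    by (intros x; unfold cubic_odd; ring).
  rewrite H in *.
  set (v := INR k + 2 - bf).
  assert (Hv : v * (bf ^ 2 + 1) = 1) by (unfold v; lra).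
  assert (Hv0 : 0 < v) by nra.
  assert (Hv1 : v * (2 * bf) <= 1).
  { rewrite <- Hv. apply Rmult_le_compat_l; nra. }
  assert (Hv2 : v * (bf + beta) <= 1).
  { apply Rle_trans with (v * (2 * bf)); [|assumption]. apply Rmult_le_compat_l; lra. }
  assert (Hd : 0 <= (bf - beta) * (beta ^ 2 + 1 - v * (bf + beta))).
  { apply Rmult_le_pos; [lra|]. nra. }
  replace (beta - (INR k + 2)) with (- (v + (bf - beta))) by (unfold v; ring).
  lra.
Qed.

Theorem theorem4p5 (m : nat) (hm : (2 <= m)%nat) (bc : R) (hbc : is_beta_c m bc) :
  (forall k : nat, m = (2 * k)%nat ->
     (forall b, calG m < b <= beta_f_even k -> card_eq1 (W b m)) /\
     (forall b, beta_f_even k < b < bc -> countably_infinite (W b m)) /\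
     continuum_card (W bc m) /\
     (forall b, bc < b <= INR m + 1 -> Rbar_lt (Finite 0) (hausdorff_dim (W b m))))
  /\
  (forall (k : nat) (bf : R), m = (2 * k + 1)%nat -> is_beta_f_odd k bf ->
     (forall b, calG m < b <= bf -> card_eq2 (W b m)) /\
     (forall b, bf < b < bc -> countably_infinite (W b m)) /\
     continuum_card (W bc m) /\
     (forall b, bc < b <= INR m + 1 -> Rbar_lt (Finite 0) (hausdorff_dim (W b m)))).
Proof.
  split.
  - intros k ->. assert (Hk : (1 <= k)%nat) by lia.
    assert (HK : 1 <= INR k) by (change 1 with (INR 1); now apply le_INR).
    assert (Hm : INR (2 * k) = 2 * INR k) by (rewrite mult_INR; reflexivity).
    destruct (is_beta_c_even k bc hbc) as [Hbc1 Hthr].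
    assert (Hbck : INR k + 1 < bc).
    { apply thr_even_pos; [assumption|]. rewrite Hthr. now apply tau_pos. }
    assert (Hbcu : bc < INR k + 2).
    { apply bound_of_thr_even; [assumption|]. rewrite Hthr. apply tau_lt. lra. }
    set (s := sqrt (INR k ^ 2 + 6 * INR k + 1)).
    assert (Hs : s * s = INR k ^ 2 + 6 * INR k + 1) by (apply sqrt_sqrt; nra).
    assert (Hs0 : 0 <= s) by apply sqrt_pos.
    assert (Hf : beta_f_even k = (INR k + 1 + s) / 2) by reflexivity. rewrite Hf.
    assert (Hsk : s < INR k + 3) by (apply Rnot_le_lt; intros Hle; nra).
    assert (Hsk' : INR k + 1 < s) by (apply Rnot_le_lt; intros Hle; nra).
    split; [|split; [|split]].
    + intros b Hb. assert (HG : calG (2 * k) = INR k + 1).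
      { unfold calG. now rewrite even_double, Nat.div2_double. }
      rewrite HG in Hb.
      apply W_even_card_1; [assumption|lra| |lra].
      apply thr_even_le_periodic; [lra|]. nra.
    + intros b Hb. apply W_even_countable; [assumption|lra|]. split.
      * apply Rnot_le_lt. rewrite thr_even_le_periodic by lra. nra.
      * apply Rlt_le_trans with (tau bc); [|apply tau_antitone; lra].
        rewrite <- Hthr. apply thr_even_lt; [assumption|lra|lra].
    + apply W_even_continuum; [assumption|lra|assumption].
    + intros b Hb. apply W_even_dim_pos; [assumption|lra|].
      apply Rle_lt_trans with (tau bc); [apply tau_antitone; lra|].
      rewrite <- Hthr. apply thr_even_lt; [assumption|lra|lra].
  - intros k bf -> Hbf. assert (Hk : (1 <= k)%nat) by lia.
    assert (HK : 1 <= INR k) by (change 1 with (INR 1); now apply le_INR).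
    assert (Hm : INR (2 * k + 1) = 2 * INR k + 1) by (rewrite plus_INR, mult_INR; reflexivity).
    destruct (is_beta_c_odd k bc hbc) as [Hbc1 Hthr].
    assert (Hbck : INR k + 1 < bc).
    { apply thr_odd_pos; [assumption|]. rewrite Hthr. now apply tau_pos. }
    assert (Hbcu : bc < INR k + 2).
    { apply bound_of_thr_odd; [assumption|]. rewrite Hthr. apply tau_lt. lra. }
    assert (Hbfb := beta_f_odd_bounds k bf Hk Hbf).
    split; [|split; [|split]].
    + intros b Hb.
      set (s := sqrt (INR k ^ 2 + 6 * INR k + 5)).
      assert (Hs : s * s = INR k ^ 2 + 6 * INR k + 5) by (apply sqrt_sqrt; nra).
      assert (Hs0 : 0 <= s) by apply sqrt_pos.
      assert (HG : calG (2 * k + 1) = (INR k + 1 + s) / 2).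
      { unfold calG. now rewrite even_double_succ, div2_double_succ. }
      rewrite HG in Hb.
      assert (Hsk : INR k + 1 < s) by (apply Rnot_le_lt; intros Hle; nra).
      apply W_odd_card_2; [lra| |lra]. split.
      * apply periodic_lt_thr_odd; [lra|]. nra.
      * apply thr_odd_le_double; [lra|]. apply (cubic_odd_nonpos k bf); [assumption|lra].
    + intros b Hb. apply W_odd_countable; [lra|]. split.
      * apply Rnot_le_lt. rewrite thr_odd_le_double by lra.
        assert (H := cubic_odd_pos k bf b Hk Hbf (proj1 Hb)). lra.
      * apply Rlt_le_trans with (tau bc); [|apply tau_antitone; lra].
        rewrite <- Hthr. apply thr_odd_lt; [assumption|lra|lra].
    + apply W_odd_continuum; [lra|assumption].
    + intros b Hb. apply W_odd_dim_pos; [lra|].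
      apply Rle_lt_trans with (tau bc); [apply tau_antitone; lra|].
      rewrite <- Hthr. apply thr_odd_lt; [assumption|lra|lra].
Qed.
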